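(* Let $(X_0,X_1)$ be a compatible couple and $1<q\le\infty$. Let $a\in SV(0,\infty)$ satisfy $$\int_0^\infty t^{-1}a^{-q'}(t)\,dt<\infty .$$ Let $\alpha\in SV(0,\infty)$ be such that $$\int_0^x t^{-1}\alpha^{-q'}(t)\,dt<\infty\ \text{ for all } x>0,\qquad \int_0^\infty t^{-1}\alpha^{-q'}(t)\,dt=\infty,$$ let $A\in SV(0,\infty)$ be given by $$A(x):=a(x)\ \text{ if } x\in(0,1],\qquad A(x)\approx\alpha(x)\ \text{ if } x\in(1,\infty),$$ and put $$B(x):=A^{-q'/q}(x)\left(\int_0^x t^{-1}A^{-q'}(t)\,dt\right)^{-1}\quad\text{for all } x>0$$ (so $B(x)=\left(\int_0^x t^{-1}A^{-1}(t)\,dt\right)^{-1}$ if $q=\infty$). Then $$(X_0,X_1)_{0,q,a;J}=(X_0,X_1)_{0,q,a;J;(0,1)},$$ $$(X_0,X_0\cap X_1)_{0,q,A;J}=(X_0,X_0\cap X_1)_{0,q,A;J;(0,1)},$$ $$(X_0,X_0\cap X_1)_{0,q,B;K}=(X_0,X_0\cap X_1)_{0,q,B;K;(0,1)}.$$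
   Context: A pair $(Y_0,Y_1)$ of Banach spaces is a compatible couple if there is a Hausdorff topological vector space in which both are continuously embedded. $Y_0\cap Y_1$ carries the norm $\max\{\|f\|_{Y_0},\|f\|_{Y_1}\}$ and $Y_0+Y_1$ the norm $\inf\{\|f_0\|_{Y_0}+\|f_1\|_{Y_1}: f=f_0+f_1\}$. For $t>0$, $$K(f,t;Y_0,Y_1):=\inf\{\|f_0\|_{Y_0}+t\|f_1\|_{Y_1}: f=f_0+f_1,\ f_0\in Y_0,\ f_1\in Y_1\}\quad (f\in Y_0+Y_1),$$ $$J(f,t;Y_0,Y_1):=\max\{\|f\|_{Y_0},t\|f\|_{Y_1}\}\quad (f\in Y_0\cap Y_1).$$ For $1\le q\le\infty$, $\|\cdot\|_{q,(c,d)}$ is the $L_q$-norm on $(c,d)$, $1/q+1/q'=1$, and $1/\infty=0$. For an interval $I=(0,\infty)$ or $I=(0,1)$ and a weight $v$ define: - the $K$-space on $I$: all $f\in Y_0+Y_1$ with $\|t^{-1/q}v(t)K(f,t;Y_0,Y_1)\|_{q,I}<\infty$, this expression being the norm; - the $J$-space on $I$: all $f\in Y_0+Y_1$ for which there is a strongly measurable $u:I\to Y_0\cap Y_1$ with $f=\int_I u(s)\,\frac{ds}{s}$ (convergence in $Y_0+Y_1$) and for which $\inf\|t^{-1/q}v(t)J(u(t),t;Y_0,Y_1)\|_{q,I}$ is finite, the infimum (which is the norm of $f$) being over all such representations of $f$. For $I=(0,\infty)$ these are denoted $(Y_0,Y_1)_{0,q,v;K}$ and $(Y_0,Y_1)_{0,q,v;J}$;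 for $I=(0,1)$ they are denoted $(Y_0,Y_1)_{0,q,v;K;(0,1)}$ and $(Y_0,Y_1)_{0,q,v;J;(0,1)}$. Equality of two spaces means that they are equal as sets and their norms are equivalent. For non-negative expressions, $\mathcal A\approx\mathcal B$ means that each is bounded by a positive constant multiple of the other, the constants being independent of the significant quantities (here, of $x$). $SV(0,\infty)$ is the set of slowly varying functions: positive, finite, Lebesgue-measurable functions $b$ on $(0,\infty)$ such that for each $\varepsilon>0$, $t^{\varepsilon}b(t)$ is equivalent ($\approx$) to a non-decreasing function on $(0,\infty)$ and $t^{-\varepsilon}b(t)$ is equivalent to a non-increasing function on $(0,\infty)$. *)

(* Defs.v *)
From HB Require Import structures.
From mathcomp Require Import all_boot all_order all_algebra.
From mathcomp Require Import all_classical all_reals all_analysis.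
Set Implicit Arguments.
Unset Strict Implicit.
Unset Printing Implicit Defensive.
Import Order.TTheory GRing.Theory Num.Theory.
Import numFieldNormedType.Exports.
Local Open Scope classical_set_scope.
Local Open Scope ring_scope.

(* The real line with the sigma-algebra of Lebesgue-measurable sets; as a bare
   type it is convertible to [R]. *)
Notation lebesgueType R := (caratheodory_type (@wlength R idfun)^*%mu).
Notation leb := (@completed_lebesgue_measure _).

Definition equivalent_on (R : realType) (T : Type) (D : set T)
    (f g : T -> R) : Prop :=
  exists c1 c2 : R, [/\ 0 < c1, 0 < c2 &
    forall x, D x -> f x <= c1 * g x /\ g x <= c2 * f x].

Definition slowly_varying (R : realType) (b : R -> R) : Prop :=
  [/\ measurable_fun (`]0, +oo[ : set (lebesgueType R)) b,
      forall t, 0 < t -> 0 < b t &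
      forall eps : R, 0 < eps ->
        (exists2 g : R -> R, {in `]0, +oo[ &, {homo g : x y / x <= y}} &
           equivalent_on `]0, +oo[ (fun t => t `^ eps * b t) g) /\
        (exists2 g : R -> R, {in `]0, +oo[ &, {homo g : x y / x <= y >-> y <= x}} &
           equivalent_on `]0, +oo[ (fun t => t `^ (- eps) * b t) g)].

(* The data of a normed space whose elements are vectors of [Z]. The values of
   [nrm] outside [space] are irrelevant. *)
Record normed_in (R : realType) (Z : lmodType R) := NormedIn {
  space : set Z ;
  nrm : Z -> R }.

Definition same_space (R : realType) (Z : lmodType R) (E F : normed_in Z) :=
  space E = space F /\ equivalent_on (space E) (nrm E) (nrm F).

(* [X] regarded as a subspace of [Z] through the injection [i]. *)
Definition embedded (R : realType) (Z : lmodType R) (X : normedModType R)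
    (i : X -> Z) : normed_in Z :=
  NormedIn (range i) (fun z => `|xget 0 (i @^-1` [set z])|).

Definition compatible_couple (R : realType) (Z : topologicalLmodType R)
    (X0 X1 : completeNormedModType R)
    (i0 : {linear X0 -> Z}) (i1 : {linear X1 -> Z}) : Prop :=
  [/\ hausdorff_space Z, injective i0, continuous i0,
      injective i1 & continuous i1].

Section functionals.
Context {R : realType} {Z : lmodType R}.
Implicit Types (Y : normed_in Z) (f : Z) (t : R).

Definition capS Y0 Y1 : normed_in Z :=
  NormedIn (space Y0 `&` space Y1) (fun f => Num.max (nrm Y0 f) (nrm Y1 f)).

Definition sumS Y0 Y1 : normed_in Z :=
  NormedIn
    [set f | exists f0 f1, [/\ space Y0 f0, space Y1 f1 & f = f0 + f1]]
    (fun f => inf [set r | exists f0 f1, [/\ space Y0 f0, space Y1 f1,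
                               f = f0 + f1 & r = nrm Y0 f0 + nrm Y1 f1]]).

Definition Kfun Y0 Y1 f t : R :=
  inf [set r | exists f0 f1, [/\ space Y0 f0, space Y1 f1,
                   f = f0 + f1 & r = nrm Y0 f0 + t * nrm Y1 f1]].

Definition Jfun Y0 Y1 f t : R := Num.max (nrm Y0 f) (t * nrm Y1 f).

End functionals.

Section bochner.
Context d {T : measurableType d} {R : realType} {Z : lmodType R}.
Variable mu : {measure set T -> \bar R}.
Implicit Types (D : set T) (Y : normed_in Z) (s : {fimfun T >-> Z}).

Definition simple_on D Y s : Prop :=
  forall z, (s @` D) z -> space Y z /\ measurable (D `&` s @^-1` [set z]).

Definition integrable_simple_on D Y s : Prop :=
  simple_on D Y s /\
  forall z, (s @` D) z -> z != 0 -> (mu (D `&` s @^-1` [set z]) < +oo)%E.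

Definition simple_integral D s : Z :=
  \sum_(z \in s @` D) fine (mu (D `&` s @^-1` [set z])) *: z.

Definition strongly_measurable D Y (u : T -> Z) : Prop :=
  (forall t, D t -> space Y (u t)) /\
  exists2 s_ : nat -> {fimfun T >-> Z}, (forall n, simple_on D Y (s_ n)) &
    \forall t \ae mu, D t -> nrm Y (u t - s_ n t) @[n --> \oo] --> (0 : R).

(* [f] is the Bochner integral of [u] over [D] in the space [Y]. *)
Definition is_bochner_integral D Y (u : T -> Z) (f : Z) : Prop :=
  [/\ strongly_measurable D Y u, space Y f &
      exists s_ : nat -> {fimfun T >-> Z},
        [/\ forall n, integrable_simple_on D Y (s_ n),
            (\int[mu]_(t in D) (nrm Y (u t - s_ n t))%:E)%E @[n --> \oo]
              --> 0%E &
            nrm Y (simple_integral D (s_ n) - f) @[n --> \oo] --> (0 : R)]].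

End bochner.

Section interpolation.
Context {R : realType} {Z : lmodType R}.
Implicit Types (Y : normed_in Z) (q : \bar R) (v : R -> R) (I : set R).

(* The L_q-norm over [I] of t^(-1/q) v(t) h(t); for q = +oo the library's
   inverse of +oo is 0. *)
Definition weighted_norm q v I (h : R -> R) : \bar R :=
  Lnorm leb q
    ((fun t : lebesgueType R =>
        (t `^ (- fine (q^-1)%E) * v t * h t)%:E) \_ I).

Definition Knorm Y0 Y1 q v I (f : Z) : \bar R :=
  weighted_norm q v I (Kfun Y0 Y1 f).

Definition Kspace Y0 Y1 q v I : normed_in Z :=
  NormedIn
    [set f | space (sumS Y0 Y1) f /\ (Knorm Y0 Y1 q v I f < +oo)%E]
    (fun f => fine (Knorm Y0 Y1 q v I f)).

Definition Jrepresents Y0 Y1 I (u : lebesgueType R -> Z) (f : Z) : Prop :=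
  strongly_measurable leb I (capS Y0 Y1) u /\
  is_bochner_integral leb I (sumS Y0 Y1)
    (fun s : lebesgueType R => s^-1 *: u s) f.

(* Equal to +oo when [f] has no representation. *)
Definition Jnorm Y0 Y1 q v I (f : Z) : \bar R :=
  ereal_inf [set weighted_norm q v I (fun t => Jfun Y0 Y1 (u t) t)
            | u in [set u | Jrepresents Y0 Y1 I u f]].

Definition Jspace Y0 Y1 q v I : normed_in Z :=
  NormedIn
    [set f | space (sumS Y0 Y1) f /\ (Jnorm Y0 Y1 q v I f < +oo)%E]
    (fun f => fine (Jnorm Y0 Y1 q v I f)).

End interpolation.

(* Main.v *)
Require Import Defs.
From HB Require Import structures.
From mathcomp Require Import all_boot all_order all_algebra.
From mathcomp Require Import all_classical all_reals all_analysis.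
From mathcomp Require Import measurable_realfun ess_sup_inf ring.
(* last, as [space] is also a name in the algebra library *)
Import Defs.
Set Implicit Arguments.
Unset Strict Implicit.
Unset Printing Implicit Defensive.
Import Order.TTheory GRing.Theory Num.Theory.
Import numFieldNormedType.Exports.
Local Open Scope classical_set_scope.
Local Open Scope ring_scope.

(** The half-line (0, oo) and the interval (0, 1) differ by the tail [1, oo), on
    which each functional is governed by a single norm.

    J-spaces. Let f be the integral of u(s)/s over (0, oo). On the tail the norm
    of u(s) in the intersection is at most psi(s) times the J-functional, with
    psi = 1 for the couple of X0 and X1, and psi(s) = 1/s for the couple of X0 and
    its intersection with X1. If psi/v, with v the weight, has a finite dual norm
    there, then by Hoelder's inequality u(s)/s is Bochner integrable over the tail
    in the intersection, and the norm of its integral g is at most a constant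
    times the norm of u ([ex_tail_integral]). Adding 2 s g to u(s) for s in
    (1/2, 1) makes up for the lost tail, since this interval has length 1/2; the
    weight being bounded there, it costs a multiple of the norm of g
    ([ex_Jrepresents_head]). Conversely a representation over (0, 1) is extended
    by zero ([Jnorm_le_head]). For psi = 1 the dual norm is finite by assumption;
    for psi(s) = 1/s it is finite for every slowly varying weight
    ([slowly_varying_tail_lty]).

    K-spaces. When Y1 embeds in Y0 with a larger norm, t |f|_0 <= K(f, t) for
    t <= 1, and K(f, t) <= |f|_0 for all t. By the first bound the norm over (0, 1)
    controls |f|_0; by the second the tail contributes at most |f|_0 times the norm
    of the weight on the tail ([same_Kspace]). For finite q the q-th power of the
    weight B, with its factor 1/t, is w W^(-q), where W is the primitive of
    w = t^(-1) A^(-q'), and a density multiplied by a power of its primitive below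
    -1 is always integrable at infinity ([integral_primitive_powR_lty]).

    The vectors live in one space Z that carries several norms, and the Bochner
    integral in each of them is defined by approximation with simple functions.
    Two facts about it carry the argument: a strongly measurable function with
    integrable norm has an integral when the norm is complete
    ([ex_bochner_integral]), and the tail of an integral in the sum may be computed
    in the intersection ([is_bochner_integralB]). *)

(** * Sequences tending to zero *)

Lemma cvg0_le (R : realType) (a b : nat -> R) : (forall n, 0 <= a n <= b n) ->
  b n @[n --> \oo] --> (0 : R) -> a n @[n --> \oo] --> (0 : R).
Proof.
move=> ab b0; apply: (@squeeze_cvgr _ _ _ _ (fun=> 0) b) => //.
- by near=> n; exact: ab.
- exact: cvg_cst.
Unshelve. all: by end_near. Qed.

Lemma cvge0_le (R : realType) (a : nat -> \bar R) (b : nat -> \bar R) :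
  (forall n, 0 <= a n <= b n)%E -> b n @[n --> \oo] --> 0%E ->
  a n @[n --> \oo] --> 0%E.
Proof.
move=> ab b0; apply: (@squeeze_cvge _ _ _ _ (fun=> 0%E) _ b) => //.
  by apply: nearW => n; exact: ab.
exact: cvg_cst.
Qed.

Lemma cvge0D (R : realType) (a : nat -> \bar R) (b : nat -> \bar R) :
  a n @[n --> \oo] --> 0%E -> b n @[n --> \oo] --> 0%E ->
  (a n + b n)%E @[n --> \oo] --> 0%E.
Proof. by move=> a0 b0; rewrite -[X in _ --> X](adde0 0%E); apply: cvgeD. Qed.

Lemma cvge0_near_le (R : realType) (a : nat -> \bar R) (e : R) : 0 < e ->
  a n @[n --> \oo] --> 0%E -> \forall n \near \oo, (a n <= e%:E)%E.
Proof.
move=> e0 /fine_cvgP[fina /cvgrPdist_le /(_ _ e0) a0].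
apply: filterS2 fina a0 => n fina; rewrite sub0r normrN => h.
by rewrite -(fineK fina) lee_fin (le_trans (ler_norm _)).
Qed.

(** * Functions with finitely many values *)

Section finitely_valued.
Context d (T : measurableType d).
Implicit Types (D E : set T).

(** Finitely many values on [D], with measurable fibers; the values on the
    complement of [D] are unconstrained, as for simple functions. *)
Definition fin_meas (P : Type) D (p : T -> P) : Prop :=
  finite_set (p @` D) /\ forall z, measurable (D `&` p @^-1` [set z]).

Lemma fin_meas_preimage (P : choiceType) D (p : T -> P) (A : set P) :
  fin_meas D p -> measurable (D `&` p @^-1` A).
Proof.
move=> [fp mp].
rewrite (_ : _ `&` _ = \bigcup_(z in A `&` p @` D) (D `&` p @^-1` [set z])).
  by apply: fin_bigcup_measurable => [|z _]; [exact: finite_setIr|exact: mp].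
apply/seteqP; split=> [t [Dt Apt]|t [z [Az _] [Dt ptz]]].
  by exists (p t) => //; split => //; exists t.
by split => //; rewrite /preimage /= ptz.
Qed.

Lemma fin_meas_comp (P Q : choiceType) D (p : T -> P) (h : P -> Q) :
  fin_meas D p -> fin_meas D (h \o p).
Proof.
move=> fp; split; first by rewrite -image_comp; apply: finite_image; case: fp.
by move=> z; rewrite comp_preimage; apply: fin_meas_preimage.
Qed.

Lemma fin_meas_pair (P Q : choiceType) D (p : T -> P) (r : T -> Q) :
  fin_meas D p -> fin_meas D r -> fin_meas D (fun t => (p t, r t)).
Proof.
move=> [fp mp] [fr mr]; split.
  apply: (@sub_finite_set _ _ ((p @` D) `*` (r @` D))); last exact: finite_setX.
  by move=> _ [t Dt <-]; split; exists t.
move=> [a b]; rewrite (_ : _ `&` _ = (D `&` p @^-1` [set a]) `&`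
                                     (D `&` r @^-1` [set b])); last first.
  apply/seteqP; split=> t /=; first by move=> [Dt [-> ->]].
  by move=> [[Dt ->] [_ ->]].
exact: measurableI.
Qed.

Lemma fin_measS (P : Type) D E (p : T -> P) : measurable E -> E `<=` D ->
  fin_meas D p -> fin_meas E p.
Proof.
move=> mE ED [fp mp]; split.
  by apply: sub_finite_set fp; exact: image_subset.
move=> z; rewrite (_ : _ `&` _ = E `&` (D `&` p @^-1` [set z])).
  exact: measurableI.
by apply/seteqP; split=> t /=; [move=> [Et pt]; split => //; split => //; exact: ED
  |move=> [? []]].
Qed.

Lemma fin_meas_mem D E : measurable D -> measurable E ->
  fin_meas D (fun t => t \in E).
Proof.
move=> mD mE; split=> [|[|]].
- exact: finite_finset.
- rewrite (_ : _ `&` _ = D `&` E); first exact: measurableI.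
  by apply/seteqP; split=> t /= [Dt] /=; [move/set_mem|move/mem_set].
- rewrite (_ : _ `&` _ = D `\` E); first exact: measurableD.
  apply/seteqP; split=> t /= [Dt] /= h; split=> //; first by move/mem_set; rewrite h.
  by apply/negbTE; rewrite notin_setE.
Qed.

Lemma fin_meas_measurable d' (S : measurableType d') (P : choiceType)
    D (p : T -> P) (h : P -> S) :
  fin_meas D p -> measurable_fun D (h \o p).
Proof.
move=> fp mD B _; rewrite comp_preimage; exact: fin_meas_preimage.
Qed.

End finitely_valued.

(** * Sums weighted by the measures of fibers *)

Section weighted_sums.
Context d (T : measurableType d) (R : realType).
Variable mu : {measure set T -> \bar R}.
Implicit Types (D E : set T).

(** The integral of [F \o p] over [D] for a finitely valued [p]. A simple
    integral is the case [F = idfun]; the freedom in [F] lets two simple functions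
    be integrated through the single map [t |-> (s t, h t)]. *)
Definition fiber_sum (V : lmodType R) (P : choiceType) D (p : T -> P)
    (F : P -> V) : V :=
  \sum_(z \in p @` D) fine (mu (D `&` p @^-1` [set z])) *: F z.

(** [fine] sends an infinite measure to zero, so infinite fibers are admitted
    only where the integrand vanishes. *)
Definition fin_fibers (V : zmodType) (P : Type) D (p : T -> P) (F : P -> V) :=
  forall z, (p @` D) z -> F z != 0 -> (mu (D `&` p @^-1` [set z]) < +oo)%E.

(** A fiber of [h \o p] is a finite disjoint union of fibers of [p]. All
    the additivity of simple integrals comes from this change of variables. *)
Lemma fiber_sum_comp (V : lmodType R) (P Q : choiceType) D (p : T -> P)
    (h : P -> Q) (F : Q -> V) :
  fin_meas D p -> fin_fibers D p (F \o h) ->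
  fiber_sum D (h \o p) F = fiber_sum D p (F \o h).
Proof.
move=> fp finp; have [fpD mp] := fp.
pose G w z : V := if h z == w then fine (mu (D `&` p @^-1` [set z])) *: F (h z)
                  else 0.
have fhpD : finite_set ((h \o p) @` D) by have [] := fin_meas_comp h fp.
transitivity (\sum_(w \in (h \o p) @` D) \sum_(z \in p @` D) G w z).
  apply: eq_fsbigr => w _.
  have [Fw0|Fw0] := eqVneq (F w) 0.
    rewrite Fw0 scaler0 fsbig1 // => z _; rewrite /G.
    by case: eqP => // ->; rewrite Fw0 scaler0.
  have fA : finite_set (p @` D `&` h @^-1` [set w]) by exact: finite_setIl.
  transitivity (\sum_(z \in p @` D `&` h @^-1` [set w])
      fine (mu (D `&` p @^-1` [set z])) *: F w).
    rewrite (_ : D `&` _ = \big[setU/set0]_(z \in p @` D `&` h @^-1` [set w])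
      (D `&` p @^-1` [set z])); last first.
      rewrite fsbig_setU //; apply/seteqP; split=> [t [Dt hpt]|t [z [_ hz] [Dt pt]]].
        by exists (p t) => //; split => //; exists t.
      by split => //=; rewrite pt.
    rewrite measure_fsbig //; last first.
      by move=> z z' _ _ [t [[_ /= <-] [_ /= <-]]].
    rewrite !fsbig_finite //= -scaler_suml; congr (_ *: _).
    rewrite [X in fine X = _]big_seq [RHS]big_seq sum_fine // => z.
    rewrite in_fset_set// => /set_mem [pDz hz].
    by rewrite ge0_fin_numE //; apply: finp => //=; rewrite hz.
  rewrite fsbig_mkcondr; apply: eq_fsbigr => z _; rewrite /G.
  have [hz|hz] := eqVneq (h z) w.
    by rewrite mem_set // hz.
  by rewrite memNset // => /eqP; rewrite (negbTE hz).
rewrite exchange_fsbig //; apply: eq_fsbigr => z /set_mem[t Dt ptz].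
rewrite (fsbigD1 (h z)) //=; last by exists t => //=; rewrite ptz.
rewrite {1}/G eqxx fsbig1 ?addr0 // => w [_ /= /eqP wz].
by rewrite /G eq_sym (negbTE wz).
Qed.

Lemma integral_fin_meas (P : choiceType) D (p : T -> P) (F : P -> R) :
  measurable D -> fin_meas D p -> (forall z, 0 <= F z) ->
  fin_fibers D p F ->
  (\int[mu]_(t in D) (F (p t))%:E =
   (\sum_(z \in p @` D) fine (mu (D `&` p @^-1` [set z])) * F z)%:E)%E.
Proof.
move=> mD fp F0 finp; have [fpD mp] := fp.
transitivity (\int[mu]_(t in D) (\sum_(z \in p @` D)
    ((F z)%:E * (\1_(D `&` p @^-1` [set z]) t)%:E)))%E.
  apply: eq_integral => t /set_mem Dt.
  rewrite (fsbigD1 (p t)) //=; last by exists t.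
  rewrite indicE mem_set // mule1 fsbig1 ?adde0 // => z [_ /= ptz].
  by rewrite indicE memNset ?mule0 // => -[_ /= /esym].
rewrite ge0_integral_fsum //; last 2 first.
- move=> z; apply: measurable_funeM; apply/measurable_EFinP.
  exact: measurable_indic.
- by move=> z t _; rewrite mule_ge0 // lee_fin // indicE.
rewrite !fsbig_finite // -sumEFin big_seq [RHS]big_seq.
apply: eq_bigr => z; rewrite in_fset_set // => /set_mem pDz.
rewrite ge0_integralZl //; last 2 first.
- by apply/measurable_EFinP; exact: measurable_indic.
- by rewrite lee_fin.
rewrite integral_indic // setIC setIA setIid.
have [->|Fz0] := eqVneq (F z) 0; first by rewrite mul0e mulr0.
by rewrite mulrC EFinM fineK // ge0_fin_numE // finp.
Qed.

Lemma fiber_sumD (V : lmodType R) (P : choiceType) D (p : T -> P)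
    (F G : P -> V) : fin_meas D p ->
  fiber_sum D p (fun z => F z + G z) = fiber_sum D p F + fiber_sum D p G.
Proof.
move=> [fp _]; rewrite /fiber_sum !fsbig_finite // -big_split.
by apply: eq_bigr => z _; rewrite scalerDr.
Qed.

Lemma fiber_sumN (V : lmodType R) (P : choiceType) D (p : T -> P)
    (F : P -> V) : fin_meas D p ->
  fiber_sum D p (fun z => - F z) = - fiber_sum D p F.
Proof.
move=> [fp _]; rewrite /fiber_sum !fsbig_finite // -sumrN.
by apply: eq_bigr => z _; rewrite scalerN.
Qed.

(** Cutting a function off by zero only enlarges the fiber over zero, which
    contributes nothing. *)
Lemma fiber_sum_cut (V : lmodType R) D E (s : T -> V) : E `<=` D ->
  fiber_sum D (fun t => if t \in E then s t else 0) idfun =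
  fiber_sum E s idfun.
Proof.
move=> ED; rewrite /fiber_sum /=.
pose F z := fine (mu (E `&` s @^-1` [set z])) *: z.
have FE z : z != 0 -> D `&` (fun t => if t \in E then s t else 0) @^-1` [set z] =
    E `&` s @^-1` [set z].
  move=> z0; apply/seteqP; split=> t /= [].
    by case: ifPn => [/set_mem Et _|_ _ z0'] //; rewrite -z0' eqxx in z0.
  by move=> Et stz; rewrite mem_set //; split => //; exact: ED.
transitivity (\sum_(z \in (s @` E) `|` [set 0]) F z).
  rewrite (@fsbig_widen _ _ _ _ ((fun t => if t \in E then s t else 0) @` D)
                        (s @` E `|` [set 0])).
  - apply: eq_fsbigr => z _; rewrite /F.
    by have [->|z0] := eqVneq z 0; [rewrite !scaler0|rewrite FE].
  - move=> _ [t Dt <-] /=; case: ifPn => [/set_mem Et|_]; last by right.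
    by left; exists t.
  - move=> z /= [[[t Et <-]|->] nz]; last by rewrite scaler0.
    exfalso; apply: nz; exists t; first exact: ED.
    by rewrite mem_set.
apply/esym/fsbig_widen => // z [[[t Et <-]|-> _]] //=; last first.
  by rewrite /F scaler0.
by case; exists t.
Qed.

End weighted_sums.

(** * Seminormed subspaces *)

(** Homogeneity is an inequality because that is what an infimum over
    decompositions gives directly; the converse inequality follows from it. *)
Record seminormed (R : realType) (Z : lmodType R) (Y : normed_in Z) : Prop :=
  Seminormed {
    space0 : space Y 0 ;
    spaceD : forall x y, space Y x -> space Y y -> space Y (x + y) ;
    spaceZ : forall (c : R) x, space Y x -> space Y (c *: x) ;
    nrm_ge0 : forall x, 0 <= nrm Y x ;
    ler_nrmD : forall x y, space Y x -> space Y y ->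
      nrm Y (x + y) <= nrm Y x + nrm Y y ;
    ler_nrmZ : forall (c : R) x, space Y x -> nrm Y (c *: x) <= `|c| * nrm Y x }.

Definition complete_in (R : realType) (Z : lmodType R) (Y : normed_in Z) :=
  forall x_ : nat -> Z, (forall n, space Y (x_ n)) ->
    (forall e : R, 0 < e -> exists N, forall m n, (N <= m)%N -> (N <= n)%N ->
       nrm Y (x_ m - x_ n) <= e) ->
    exists2 x, space Y x & nrm Y (x_ n - x) @[n --> \oo] --> (0 : R).

Section seminormed_theory.
Context (R : realType) (Z : lmodType R) (Y : normed_in Z).
Hypothesis sY : seminormed Y.

Lemma nrm0 : nrm Y 0 = 0.
Proof.
apply/eqP; rewrite eq_le nrm_ge0 // andbT.
by have := ler_nrmZ sY 0 (space0 sY); rewrite scale0r normr0 mul0r.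
Qed.

Lemma spaceN x : space Y x -> space Y (- x).
Proof. by move=> Yx; rewrite -scaleN1r; apply: spaceZ. Qed.

Lemma spaceB x y : space Y x -> space Y y -> space Y (x - y).
Proof. by move=> Yx Yy; apply: spaceD => //; exact: spaceN. Qed.

Lemma nrmN x : space Y x -> nrm Y (- x) = nrm Y x.
Proof.
have le y : space Y y -> nrm Y (- y) <= nrm Y y.
  by move=> Yy; rewrite -scaleN1r (le_trans (ler_nrmZ _ _ _)) // normrN normr1 mul1r.
move=> Yx; apply/eqP; rewrite eq_le le //=.
by rewrite -{1}(opprK x) le //; exact: spaceN.
Qed.

Lemma nrm_distrC x y : space Y x -> space Y y -> nrm Y (x - y) = nrm Y (y - x).
Proof. by move=> Yx Yy; rewrite -nrmN ?opprB //; exact: spaceB. Qed.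

Lemma ler_nrm_trans z x y : space Y x -> space Y y -> space Y z ->
  nrm Y (x - y) <= nrm Y (x - z) + nrm Y (z - y).
Proof.
move=> Yx Yy Yz; have -> : x - y = (x - z) + (z - y) by rewrite addrA subrK.
by apply: ler_nrmD => //; exact: spaceB.
Qed.

Lemma ler_nrm_sub x y : space Y x -> space Y y ->
  `|nrm Y x - nrm Y y| <= nrm Y (x - y).
Proof.
move=> Yx Yy; rewrite ler_norml lerNl opprB !lerBlDr; apply/andP; split.
  rewrite (nrm_distrC Yx Yy) -{1}(subrK x y).
  by apply: ler_nrmD => //; exact: spaceB.
rewrite -{1}(subrK y x).
by apply: ler_nrmD => //; exact: spaceB.
Qed.

Lemma nrm_sum_le (I : eqType) (r : seq I) (c : I -> R) (F : I -> Z) :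
  (forall i, 0 <= c i) -> (forall i, i \in r -> space Y (F i)) ->
  space Y (\sum_(i <- r) c i *: F i) /\
  nrm Y (\sum_(i <- r) c i *: F i) <= \sum_(i <- r) c i * nrm Y (F i).
Proof.
move=> c0; elim: r => [|i r IH] YF.
  by rewrite !big_nil nrm0; split => //; exact: space0.
have [Ys ns] : space Y (\sum_(j <- r) c j *: F j) /\
    nrm Y (\sum_(j <- r) c j *: F j) <= \sum_(j <- r) c j * nrm Y (F j).
  by apply: IH => j jr; apply: YF; rewrite in_cons jr orbT.
have Yi : space Y (F i) by apply: YF; rewrite mem_head.
have Yci : space Y (c i *: F i) by exact: spaceZ.
rewrite !big_cons; split; first exact: spaceD.
apply: le_trans (ler_nrmD sY Yci Ys) _; apply: lerD => //.
by rewrite (le_trans (ler_nrmZ sY _ Yi)) // ger0_norm.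
Qed.

End seminormed_theory.

(** * Simple functions and their integrals *)

Section simple_functions.
Context d (T : measurableType d) (R : realType) (Z : lmodType R).
Variable mu : {measure set T -> \bar R}.
Implicit Types (D E : set T) (Y : normed_in Z) (s h : {fimfun T >-> Z}).

Lemma simple_onP D Y s : measurable D ->
  simple_on D Y s <-> fin_meas D s /\ forall t, D t -> space Y (s t).
Proof.
move=> mD; split=> [sim|[[_ ms] Ys] z [t Dt <-]]; last by split; auto.
split; last by move=> t Dt; apply: (sim (s t) _).1; exists t.
split; first exact: fimfun_inP.
move=> z; have [Dz|nDz] := pselect ((s @` D) z); first exact: (sim _ Dz).2.
rewrite (_ : _ `&` _ = set0) // -subset0 => t [Dt /= stz].
by apply: nDz; exists t.
Qed.

(** Setting the function to zero outside [D] makes its range finite. *)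
Lemma ex_simple_on D Y (f : T -> Z) : measurable D -> fin_meas D f ->
  (forall t, D t -> space Y (f t)) ->
  exists s : {fimfun T >-> Z}, simple_on D Y s /\ forall t, D t -> s t = f t.
Proof.
move=> mD ff Yf; pose g t := if t \in D then f t else 0.
have fing : finite_set (range g).
  apply: (@sub_finite_set _ _ (f @` D `|` [set 0])).
    move=> _ [t _ <-]; rewrite /g; case: ifPn => [/set_mem Dt|_]; last by right.
    by left; exists t.
  by rewrite finite_setU; split; [case: ff|exact: finite_set1].
exists (fimfun_Sub (mem_set fing)).
have gE t : D t -> g t = f t by move=> Dt; rewrite /g mem_set.
split => //; apply/simple_onP => //; split; last by move=> t Dt /=; rewrite gE //; exact: Yf.
split; first exact: fimfun_inP.
case: ff => _ mf z; rewrite (_ : _ `&` _ = D `&` f @^-1` [set z]) //.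
by apply/seteqP; split=> t [Dt] /=; rewrite gE.
Qed.

Lemma eq_fiber_sum (V : lmodType R) (P : choiceType) D (p p' : T -> P)
    (F : P -> V) : (forall t, D t -> p t = p' t) ->
  fiber_sum mu D p F = fiber_sum mu D p' F.
Proof.
move=> pp'; rewrite /fiber_sum; have -> : p @` D = p' @` D.
  by apply/seteqP; split=> _ [t Dt <-]; exists t => //; rewrite pp'.
apply: eq_fsbigr => z _; congr (fine (mu _) *: _).
by apply/seteqP; split=> t [Dt] /=; rewrite pp'.
Qed.

Lemma nrm_fiber_sum_le (P : choiceType) D Y (p : T -> P) (F : P -> Z) :
  seminormed Y -> measurable D -> fin_meas D p -> fin_fibers mu D p F ->
  (forall t, D t -> space Y (F (p t))) ->
  ((nrm Y (fiber_sum mu D p F))%:E <= \int[mu]_(t in D) (nrm Y (F (p t)))%:E)%E.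
Proof.
move=> sY mD fp finp YF; have [fpD _] := fp.
rewrite (integral_fin_meas (F := fun z => nrm Y (F z))) //; last 2 first.
- by move=> z; exact: nrm_ge0.
- move=> z Dz nz; apply: finp => //; apply: contra_neq nz => ->.
  exact: nrm0.
rewrite lee_fin /fiber_sum !fsbig_finite //.
by apply: (nrm_sum_le _ _ _).2 => // z; rewrite in_fset_set// => /set_mem[t Dt <-]; exact: YF.
Qed.

(** A joint fiber is contained in a fiber of each component, and one of the two
    components is nonzero where [F] is. *)
Lemma fin_fibers_pair (V : zmodType) D (s h : T -> Z) (F : Z * Z -> V) :
  measurable D -> fin_meas D s -> fin_meas D h ->
  fin_fibers mu D s idfun -> fin_fibers mu D h idfun -> F (0, 0) = 0 ->
  fin_fibers mu D (fun t => (s t, h t)) F.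
Proof.
move=> mD fs fh fins finh F0 [a b] [t Dt [sta htb]] Fab.
have mab := (fin_meas_pair fs fh).2 (a, b).
have [a0|a0] := eqVneq a 0; last first.
  apply: le_lt_trans (fins a _ a0); last by exists t.
  rewrite le_measure ?inE //; first exact: fs.2.
  by move=> x [Dx [<- _]].
have b0 : b != 0 by apply: contra_neq Fab => b0; rewrite a0 b0.
apply: le_lt_trans (finh b _ b0); last by exists t.
rewrite le_measure ?inE //; first exact: fh.2.
by move=> x [Dx [_ <-]].
Qed.

Lemma fiber_sum_pair D (s h : T -> Z) :
  measurable D -> fin_meas D s -> fin_meas D h ->
  fin_fibers mu D s idfun -> fin_fibers mu D h idfun ->
  fiber_sum mu D s idfun = fiber_sum mu D (fun t => (s t, h t)) fst /\
  fiber_sum mu D h idfun = fiber_sum mu D (fun t => (s t, h t)) snd.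
Proof.
move=> mD fs fh fins finh; have fsh := fin_meas_pair fs fh; split.
- by apply: (fiber_sum_comp (h := fst) (F := idfun) fsh); exact: fin_fibers_pair.
- by apply: (fiber_sum_comp (h := snd) (F := idfun) fsh); exact: fin_fibers_pair.
Qed.

Lemma fiber_sum_funD D (s h : T -> Z) :
  measurable D -> fin_meas D s -> fin_meas D h ->
  fin_fibers mu D s idfun -> fin_fibers mu D h idfun ->
  fiber_sum mu D (fun t => s t + h t) idfun =
  fiber_sum mu D s idfun + fiber_sum mu D h idfun.
Proof.
move=> mD fs fh fins finh; have fsh := fin_meas_pair fs fh.
have [-> ->] := fiber_sum_pair mD fs fh fins finh.
rewrite -fiber_sumD //.
apply: (fiber_sum_comp (h := fun z => z.1 + z.2) (F := idfun) fsh).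
by apply: fin_fibers_pair => //=; rewrite addr0.
Qed.

Lemma nrm_fiber_sumB_le D Y (s h : T -> Z) : seminormed Y -> measurable D ->
  fin_meas D s -> fin_meas D h ->
  fin_fibers mu D s idfun -> fin_fibers mu D h idfun ->
  (forall t, D t -> space Y (s t)) -> (forall t, D t -> space Y (h t)) ->
  ((nrm Y (fiber_sum mu D s idfun - fiber_sum mu D h idfun))%:E <=
   \int[mu]_(t in D) (nrm Y (s t - h t))%:E)%E.
Proof.
move=> sY mD fs fh fins finh Ys Yh; have fsh := fin_meas_pair fs fh.
have [-> ->] := fiber_sum_pair mD fs fh fins finh.
rewrite -fiber_sumN // -fiber_sumD //.
apply: (nrm_fiber_sum_le (F := fun z => z.1 - z.2)) => //.
- by apply: fin_fibers_pair => //=; rewrite subrr.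
- by move=> t Dt /=; apply: spaceB => //; [exact: Ys|exact: Yh].
Qed.

Lemma integrable_simple_onP D Y s : measurable D ->
  integrable_simple_on mu D Y s <->
  [/\ fin_meas D s, forall t, D t -> space Y (s t) & fin_fibers mu D s idfun].
Proof.
move=> mD; split=> [[/(simple_onP _ _ mD)[fs Ys] fins]|[fs Ys fins]].
  by split.
by split => //; apply/simple_onP.
Qed.

Lemma space_simple_integral D Y s : seminormed Y -> measurable D ->
  integrable_simple_on mu D Y s -> space Y (simple_integral mu D s).
Proof.
move=> sY mD /(integrable_simple_onP _ _ mD)[fs Ys _].
rewrite /simple_integral fsbig_finite //.
apply: (nrm_sum_le sY (fun z => _) _).1 => [z|z]; first exact: fine_ge0.
by rewrite in_fset_set// => /set_mem[t Dt <-]; exact: Ys.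
Qed.

End simple_functions.

(** * Strong measurability *)

Section strong_measurability.
Context d (T : measurableType d) (R : realType) (Z : lmodType R).
Variable mu : {measure set T -> \bar R}.
Implicit Types (D E : set T) (Y : normed_in Z) (u w : T -> Z).

(** Only the values of the approximants on [D] matter, so that they may be
    given as plain functions. *)
Lemma strongly_measurableP D Y u : measurable D ->
  strongly_measurable mu D Y u <->
  (forall t, D t -> space Y (u t)) /\
  exists s_ : nat -> T -> Z,
    [/\ forall n, fin_meas D (s_ n), forall n t, D t -> space Y (s_ n t) &
        \forall t \ae mu, D t -> nrm Y (u t - s_ n t) @[n --> \oo] --> (0 : R)].
Proof.
move=> mD; split=> -[Yu].
  move=> [s_ sim us]; split => //; exists (fun n => s_ n : T -> Z); split => //.
  - by move=> n; have [] := (simple_onP Y (s_ n) mD).1 (sim n).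
  - by move=> n; have [] := (simple_onP Y (s_ n) mD).1 (sim n).
move=> [f_ [fm Yf uf]]; split => //.
have [s_ hs] := choice (fun n => ex_simple_on mD (fm n) (Yf n)).
exists s_; first by move=> n; exact: (hs n).1.
apply: filterS uf => t uf Dt; have := uf Dt.
by under eq_fun do rewrite -(hs _).2 //.
Qed.

Lemma eq_strongly_measurable D Y u w : measurable D ->
  (forall t, D t -> u t = w t) ->
  strongly_measurable mu D Y u -> strongly_measurable mu D Y w.
Proof.
move=> mD uw /(strongly_measurableP _ _ mD)[Yu [s_ [fs Ys us]]].
apply/strongly_measurableP => //; split; first by move=> t Dt; rewrite -uw //; exact: Yu.
by exists s_; split => //; apply: filterS us => t us Dt; rewrite -uw //; exact: us.
Qed.

Lemma strongly_measurable_cst D Y z : measurable D -> seminormed Y ->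
  space Y z -> strongly_measurable mu D Y (fun=> z).
Proof.
move=> mD sY Yz; apply/strongly_measurableP => //; split => //.
exists (fun=> cst z); split => //.
- move=> _; split; first by apply: sub_finite_set (finite_set1 z) => _ [t _ <-].
  move=> y; have [->|yz] := eqVneq y z.
    by rewrite (_ : _ `&` _ = D) //; apply/seteqP; split=> t // -[].
  rewrite (_ : _ `&` _ = set0) // -subset0 => t [_ /= /eqP].
  by rewrite eq_sym (negbTE yz).
- by apply/aeW => t Dt; under eq_fun do rewrite subrr (nrm0 sY); exact: cvg_cst.
Qed.

Lemma strongly_measurableD D Y u w : measurable D -> seminormed Y ->
  strongly_measurable mu D Y u -> strongly_measurable mu D Y w ->
  strongly_measurable mu D Y (fun t => u t + w t).
Proof.
move=> mD sY /(strongly_measurableP _ _ mD)[Yu [s_ [fs Ys us]]].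
move=> /(strongly_measurableP _ _ mD)[Yw [h_ [fh Yh wh]]].
apply/strongly_measurableP => //; split.
  by move=> t Dt; apply: spaceD; auto.
exists (fun n t => s_ n t + h_ n t); split.
- by move=> n; exact: (fin_meas_comp (fun z => z.1 + z.2) (fin_meas_pair (fs n) (fh n))).
- by move=> n t Dt; apply: spaceD; auto.
apply: filterS2 us wh => t us wh Dt.
apply: (@cvg0_le R _ (fun n => nrm Y (u t - s_ n t) + nrm Y (w t - h_ n t))).
  move=> n; rewrite nrm_ge0 //= opprD addrACA.
  by apply: ler_nrmD => //; apply: spaceB; auto.
by rewrite -[X in _ --> X](addr0 0); apply: cvgD; [exact: us|exact: wh].
Qed.

Import HBSimple.

(** [f u - g s = (f - g) u + g (u - s)] for approximants [g] of [f] and [s] of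
    [u]. *)
Lemma strongly_measurableZ D Y (f : T -> R) u : measurable D -> seminormed Y ->
  measurable_fun D f -> strongly_measurable mu D Y u ->
  strongly_measurable mu D Y (fun t => f t *: u t).
Proof.
move=> mD sY mf /(strongly_measurableP _ _ mD)[Yu [s_ [fs Ys us]]].
have [g_ gf] := approximation_sfun mD ((measurable_EFinP D f).2 mf).
have fg n : fin_meas D (g_ n).
  split; first exact: fimfun_inP.
  by move=> z; apply: measurableI => //; exact: measurable_sfunP.
apply/strongly_measurableP => //; split.
  by move=> t Dt; apply: spaceZ; auto.
exists (fun n t => g_ n t *: s_ n t); split.
- by move=> n; exact: (fin_meas_comp (fun z => z.1 *: z.2) (fin_meas_pair (fg n) (fs n))).
- by move=> n t Dt; apply: spaceZ; auto.
apply: filterS us => t us Dt.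
have {}gf : g_ n t @[n --> \oo] --> f t by have /fine_cvgP[] := gf t Dt.
apply: (@cvg0_le R _ (fun n => `|f t - g_ n t| * nrm Y (u t) +
                             `|g_ n t| * nrm Y (u t - s_ n t))).
  move=> n; rewrite nrm_ge0 //=.
  have -> : f t *: u t - g_ n t *: s_ n t =
      (f t - g_ n t) *: u t + g_ n t *: (u t - s_ n t).
    by rewrite scalerBl scalerBr addrA subrK.
  have Yus : space Y (u t - s_ n t) by apply: spaceB; auto.
  apply: le_trans (ler_nrmD sY _ _) _; try by apply: spaceZ; auto.
  by apply: lerD; apply: ler_nrmZ; auto.
rewrite -[X in _ --> X](addr0 0); apply: cvgD.
  rewrite -(mul0r (nrm Y (u t))); apply: cvgMl.
  rewrite -(@normr0 _ R) -(subrr (f t)); apply: cvg_norm; apply: cvgB => //.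
  exact: cvg_cst.
rewrite -(mulr0 `|f t|); apply: cvgM; last exact: us.
exact: cvg_norm.
Qed.

Lemma strongly_measurable_le D Y Y' u : measurable D -> seminormed Y ->
  seminormed Y' -> space Y `<=` space Y' ->
  (forall x, space Y x -> nrm Y' x <= nrm Y x) ->
  strongly_measurable mu D Y u -> strongly_measurable mu D Y' u.
Proof.
move=> mD sY sY' YY' nYY' /(strongly_measurableP _ _ mD)[Yu [s_ [fs Ys us]]].
apply/strongly_measurableP => //; split; first by auto.
exists s_; split; [by []|by auto|].
apply: filterS us => t us Dt; apply: cvg0_le (us Dt) => n.
by rewrite nrm_ge0 //= nYY' //; apply: spaceB; auto.
Qed.

Lemma strongly_measurableS D E Y u : measurable D -> measurable E ->
  E `<=` D -> strongly_measurable mu D Y u -> strongly_measurable mu E Y u.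
Proof.
move=> mD mE ED /(strongly_measurableP _ _ mD)[Yu [s_ [fs Ys us]]].
apply/strongly_measurableP => //; split; first by auto.
exists s_; split; [|by auto|by apply: filterS us => t us /ED].
by move=> n; apply: fin_measS (fs n).
Qed.

Lemma fin_meas_cut D E (s : T -> Z) : measurable D -> measurable E ->
  E `<=` D -> fin_meas E s -> fin_meas D (fun t => if t \in E then s t else 0).
Proof.
move=> mD mE ED [fs ms]; split.
  apply: (@sub_finite_set _ _ (s @` E `|` [set 0])).
    move=> _ [t _ <-]; case: ifPn => [/set_mem Et|_]; last by right.
    by left; exists t.
  by rewrite finite_setU; split => //; exact: finite_set1.
move=> z; have [z0|z0] := eqVneq z 0.
  rewrite (_ : _ `&` _ = (D `\` E) `|` (E `&` s @^-1` [set z])).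
    by apply: measurableU => //; exact: measurableD.
  apply/seteqP; split=> [t [Dt] /=|t /= [[Dt nEt]|[Et stz]]].
  - by case: ifPn => [/set_mem Et ?|/negP nEt _]; [right|left; split => // /mem_set].
  - by rewrite memNset.
  - by split; [exact: ED|rewrite mem_set].
rewrite (_ : _ `&` _ = E `&` s @^-1` [set z]) //.
apply/seteqP; split=> [t [Dt] /=|t /= [Et stz]].
- by case: ifPn => [/set_mem Et ?|_ z0'] //; rewrite z0' eqxx in z0.
- by split; [exact: ED|rewrite mem_set].
Qed.

Lemma strongly_measurable_cut D E Y u : measurable D -> measurable E ->
  seminormed Y -> E `<=` D -> strongly_measurable mu E Y u ->
  strongly_measurable mu D Y (fun t => if t \in E then u t else 0).
Proof.
move=> mD mE sY ED /(strongly_measurableP _ _ mE)[Yu [s_ [fs Ys us]]].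
apply/strongly_measurableP => //; split.
  by move=> t Dt; case: ifPn => [/set_mem /Yu //|_]; exact: space0.
exists (fun n t => if t \in E then s_ n t else 0); split.
- by move=> n; exact: fin_meas_cut.
- by move=> n t Dt; case: ifPn => [/set_mem /Ys //|_]; exact: space0.
apply: filterS us => t us Dt; case: ifPn => [/set_mem /us //|_].
by under eq_fun do rewrite subrr (nrm0 sY); exact: cvg_cst.
Qed.

(** The norms of the approximants converge almost everywhere; completeness of
    the measure absorbs the exceptional set. *)
Lemma measurable_nrm D Y u : measurable D -> measure_is_complete mu ->
  seminormed Y -> strongly_measurable mu D Y u ->
  measurable_fun D (fun t => nrm Y (u t)).
Proof.
move=> mD cmu sY /(strongly_measurableP _ _ mD)[Yu [s_ [fs Ys us]]].
case: us => N [mN N0 usN].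
pose g t := if t \in N then 0 else nrm Y (u t).
suff mg : measurable_fun D g.
  apply/measurable_EFinP; apply: (@ae_measurable_fun _ _ _ mu cmu _ (EFin \o g)).
    exists N; split => // t /= h; apply: contrapT => Nt; apply: h => Dt.
    by rewrite /g memNset.
  exact/measurable_EFinP.
apply: (@measurable_fun_cvg _ _ _ D
  (fun n t => if t \in N then 0 else nrm Y (s_ n t))).
  move=> n.
  have mN' : fin_meas D (fun t => t \in N) by exact: fin_meas_mem.
  exact: (fin_meas_measurable (fun z => if z.1 then 0 else nrm Y z.2)
            (fin_meas_pair mN' (fs n))).
move=> t Dt; rewrite /g; case: ifPn => [_|/negP Nt]; first exact: cvg_cst.
have {}us : nrm Y (u t - s_ n t) @[n --> \oo] --> (0 : R).
  apply: contrapT => h; apply: Nt; apply/mem_set/usN => /= h'; exact/h/h'.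
apply/subr_cvg0/norm_cvg0P.
apply: cvg0_le us => n; rewrite normr_ge0 /= (nrm_distrC sY) //; auto.
by apply: ler_nrm_sub => //; auto.
Qed.

End strong_measurability.

(** * The Bochner integral *)

Section bochner_approximation.
Context d (T : measurableType d) (R : realType) (Z : lmodType R).
Variable mu : {measure set T -> \bar R}.
Implicit Types (D E : set T) (Y : normed_in Z) (u w : T -> Z).

Lemma measurable_nrmB D Y u w : measurable D -> measure_is_complete mu ->
  seminormed Y -> strongly_measurable mu D Y u -> strongly_measurable mu D Y w ->
  measurable_fun D (fun t => nrm Y (u t - w t)).
Proof.
move=> mD cmu sY mu_ mw; apply: (measurable_nrm mD cmu sY).
apply: strongly_measurableD => //.
have := strongly_measurableZ mD sY (measurable_cst (-1 : R)) mw.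
by apply: eq_strongly_measurable => // t _ /=; rewrite scaleN1r.
Qed.

Lemma strongly_measurable_fin_meas D Y (s : T -> Z) : measurable D ->
  seminormed Y -> fin_meas D s -> (forall t, D t -> space Y (s t)) ->
  strongly_measurable mu D Y s.
Proof.
move=> mD sY fs Ys; apply/strongly_measurableP => //; split => //.
exists (fun=> s); split => //; apply/aeW => t Dt.
by under eq_fun do rewrite subrr (nrm0 sY); exact: cvg_cst.
Qed.

(** The [n]-th approximant is kept only on a set [E n] of finite measure, where
    its norm is at most twice that of [u]; it is then dominated by [3 nrm u].
    Where the norm of [u] vanishes the truncated value may be either the
    approximant or zero, and both tend to [u]. *)
Lemma bochner_approx D Y u (E : nat -> set T) :
  measurable D -> measure_is_complete mu -> seminormed Y ->
  (forall n, measurable (E n)) -> (forall n, (mu (E n) < +oo)%E) ->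
  (forall t, D t -> \forall n \near \oo, E n t) ->
  strongly_measurable mu D Y u ->
  (\int[mu]_(t in D) (nrm Y (u t))%:E < +oo)%E ->
  exists s_ : nat -> {fimfun T >-> Z},
    (forall n, integrable_simple_on mu D Y (s_ n)) /\
    (\int[mu]_(t in D) (nrm Y (u t - s_ n t))%:E)%E @[n --> \oo] --> 0%E.
Proof.
move=> mD cmu sY mE Efin DE mu_ iu.
have mnu := measurable_nrm mD cmu sY mu_.
have [Yu [f_ [fs Ys us]]] := (strongly_measurableP _ _ _ mD).1 mu_.
pose G n := E n `&` (D `&` [set t | nrm Y (f_ n t) <= 2 * nrm Y (u t)]).
have mG n : measurable (G n).
  apply: measurableI => //; apply: measurable_fun_le => //.
    exact: (fin_meas_measurable (nrm Y) (fs n)).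
  by apply: measurable_funM => //; exact: measurable_cst.
have GD n : G n `<=` D by move=> t [_ []].
pose h n t := if t \in G n then f_ n t else 0.
have fh n : fin_meas D (h n).
  by apply: fin_meas_cut => //; exact: fin_measS (fs n).
have Yh n t : D t -> space Y (h n t).
  by move=> Dt; rewrite /h; case: ifP => _; [exact: Ys|exact: space0].
have finh n : fin_fibers mu D (h n) idfun.
  move=> z _ z0; apply: le_lt_trans (Efin n).
  rewrite le_measure ?inE //; first exact: (fh n).2.
  move=> t [Dt]; rewrite /h /=; case: ifPn => [/set_mem [//]|_ /esym /eqP].
  by rewrite (negbTE z0).
have mh n : strongly_measurable mu D Y (h n).
  by apply: strongly_measurable_fin_meas; [| |exact: fh|exact: Yh].
have dom n t : D t -> nrm Y (u t - h n t) <= 3 * nrm Y (u t).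
  move=> Dt; rewrite /h; case: ifPn => [/set_mem [_ [_ /= le2]]|_].
    apply: le_trans (ler_nrmD sY (Yu _ Dt) (spaceN sY (Ys n _ Dt))) _.
    rewrite nrmN //; last exact: Ys.
    by rewrite (_ : 3 = 1 + 2) // mulrDl mul1r lerD2l.
  by rewrite subr0 ler_peMl ?nrm_ge0 // ler1n.
have [s_ hs] := choice (fun n => ex_simple_on mD (fh n) (@Yh n)).
exists s_; split.
  move=> n; apply/integrable_simple_onP => //.
  have [/(simple_onP _ _ mD)[fsn Ysn] sh] := hs n.
  split => // z [t Dt stz] z0.
  have -> : D `&` s_ n @^-1` [set z] = D `&` h n @^-1` [set z].
    by apply/seteqP; split=> x [Dx] /=; rewrite sh.
  by apply: finh => //; exists t => //; rewrite -sh.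
(* the simple functions [s_ n] agree with [h n] on [D] *)
rewrite [X in X @ \oo --> _](_ : _ =
    fun n => (\int[mu]_(t in D) (nrm Y (u t - h n t))%:E)%E); last first.
  by apply/funext => n; apply: eq_integral => t /set_mem Dt; rewrite (hs n).2.
have [] := @dominated_convergence _ _ _ mu D mD
  (fun n t => (nrm Y (u t - h n t))%:E) (cst 0%E) (fun t => (3 * nrm Y (u t))%:E).
- by move=> n; apply/measurable_EFinP; exact: measurable_nrmB.
- exact: measurable_cst.
- apply: filterS us => t us Dt.
  suff : nrm Y (u t - h n t) @[n --> \oo] --> (0 : R).
    by move=> h0; apply/fine_cvgP; split => //; apply: nearW.
  have [u0|u0] := eqVneq (nrm Y (u t)) 0.
    apply: cvg0_le (us Dt) => n; rewrite nrm_ge0 //= /h; case: ifP => // _.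
    by rewrite subr0 u0 nrm_ge0.
  have {}u0 : 0 < nrm Y (u t) by rewrite lt_neqAle eq_sym u0 nrm_ge0.
  apply: cvg_trans (us Dt); apply: near_eq_cvg.
  have le1 : \forall n \near \oo, nrm Y (u t - f_ n t) <= nrm Y (u t).
    have /cvgrPdist_le /(_ _ u0) := us Dt; apply: filterS => n.
    by rewrite sub0r normrN ger0_norm // nrm_ge0.
  have := DE t Dt; apply: filterS2 le1 => n le1 Ent.
  rewrite /h mem_set //; split => //; split => //=.
  rewrite (_ : f_ n t = u t - (u t - f_ n t)); last by rewrite opprB addrC subrK.
  have Yuf : space Y (u t - f_ n t) by apply: spaceB; auto.
  apply: le_trans (ler_nrmD sY (Yu _ Dt) (spaceN sY Yuf)) _.
  by rewrite nrmN // mulr_natl mulr2n lerD2l.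
- apply/integrableP; split.
    apply/measurable_EFinP; apply: measurable_funM => //; exact: measurable_cst.
  under eq_integral do rewrite gee0_abs ?lee_fin ?mulr_ge0 ?nrm_ge0 // EFinM.
  rewrite ge0_integralZl //; last 2 first.
  + exact/measurable_EFinP.
  + by move=> t _; rewrite lee_fin nrm_ge0.
  by rewrite lte_mul_pinfty.
- by apply/aeW => t n Dt /=; rewrite lee_fin ger0_norm ?nrm_ge0 // dom.
move=> _ _; rewrite integral0; exact.
Unshelve. all: by end_near. Qed.

End bochner_approximation.

Section bochner_integral.
Context d (T : measurableType d) (R : realType) (Z : lmodType R).
Variable mu : {measure set T -> \bar R}.
Hypothesis cmu : measure_is_complete mu.
Implicit Types (D E : set T) (Y : normed_in Z) (u w : T -> Z)
  (s h : {fimfun T >-> Z}).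

Lemma integrable_simple_strongly_measurable D Y s : measurable D ->
  seminormed Y -> integrable_simple_on mu D Y s -> strongly_measurable mu D Y s.
Proof.
move=> mD sY /(integrable_simple_onP _ _ _ mD)[fs Ys _].
by apply: strongly_measurable_fin_meas; [| |exact: fs|exact: Ys].
Qed.

Lemma nrm_integral_trans D Y u w v : measurable D -> seminormed Y ->
  strongly_measurable mu D Y u -> strongly_measurable mu D Y w ->
  strongly_measurable mu D Y v ->
  (\int[mu]_(t in D) (nrm Y (w t - v t))%:E <=
   \int[mu]_(t in D) (nrm Y (u t - w t))%:E +
   \int[mu]_(t in D) (nrm Y (u t - v t))%:E)%E.
Proof.
move=> mD sY mu_ mw mv.
have muw := measurable_nrmB mD cmu sY mu_ mw.
have muv := measurable_nrmB mD cmu sY mu_ mv.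
have mwv := measurable_nrmB mD cmu sY mw mv.
rewrite -ge0_integralD //; last 4 first.
- by move=> t _; rewrite lee_fin nrm_ge0.
- exact/measurable_EFinP.
- by move=> t _; rewrite lee_fin nrm_ge0.
- exact/measurable_EFinP.
have [[Yu _] [Yw _] [Yv _]] := And3 mu_ mw mv.
apply: ge0_le_integral => //.
- by move=> t _; rewrite lee_fin nrm_ge0.
- exact/measurable_EFinP.
- by apply: emeasurable_funD; exact/measurable_EFinP.
move=> t Dt; rewrite -EFinD lee_fin (nrm_distrC sY (Yu _ Dt) (Yw _ Dt)).
by apply: ler_nrm_trans; auto.
Qed.

Lemma nrm_simple_integralB_le D Y u s h : measurable D -> seminormed Y ->
  strongly_measurable mu D Y u ->
  integrable_simple_on mu D Y s -> integrable_simple_on mu D Y h ->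
  ((nrm Y (simple_integral mu D s - simple_integral mu D h))%:E <=
   \int[mu]_(t in D) (nrm Y (u t - s t))%:E +
   \int[mu]_(t in D) (nrm Y (u t - h t))%:E)%E.
Proof.
move=> mD sY mu_ is_ ih.
have [fs Ys fins] := (integrable_simple_onP mu Y s mD).1 is_.
have [fh Yh finh] := (integrable_simple_onP mu Y h mD).1 ih.
apply: le_trans (nrm_fiber_sumB_le sY mD fs fh fins finh Ys Yh) _.
by apply: nrm_integral_trans => //; exact: integrable_simple_strongly_measurable.
Qed.

Lemma nrm_simple_integral_le D Y u s : measurable D -> seminormed Y ->
  strongly_measurable mu D Y u -> integrable_simple_on mu D Y s ->
  ((nrm Y (simple_integral mu D s))%:E <=
   \int[mu]_(t in D) (nrm Y (u t - s t))%:E +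
   \int[mu]_(t in D) (nrm Y (u t))%:E)%E.
Proof.
move=> mD sY mu_ is_.
have [fs Ys fins] := (integrable_simple_onP mu Y s mD).1 is_.
apply: le_trans (nrm_fiber_sum_le sY mD fs fins Ys) _.
have := nrm_integral_trans mD sY mu_
  (integrable_simple_strongly_measurable mD sY is_)
  (strongly_measurable_cst mu mD sY (space0 sY)).
by under eq_integral do rewrite subr0;
  under [X in (_ <= _ + X)%E]eq_integral do rewrite subr0.
Qed.

(** In a complete space the integrals of approximating simple functions form a
    Cauchy sequence, so that on a set exhausted by sets of finite measure strong
    measurability and integrability of the norm suffice for the existence of the
    Bochner integral. *)
Lemma ex_bochner_integral D Y u (E : nat -> set T) :
  measurable D -> seminormed Y -> complete_in Y ->
  (forall n, measurable (E n)) -> (forall n, (mu (E n) < +oo)%E) ->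
  (forall t, D t -> \forall n \near \oo, E n t) ->
  strongly_measurable mu D Y u ->
  (\int[mu]_(t in D) (nrm Y (u t))%:E < +oo)%E ->
  exists2 g, is_bochner_integral mu D Y u g &
    ((nrm Y g)%:E <= \int[mu]_(t in D) (nrm Y (u t))%:E)%E.
Proof.
move=> mD sY cY mE Efin DE mu_ iu.
have [s_ [is_ us]] := bochner_approx mD cmu sY mE Efin DE mu_ iu.
pose x_ n := simple_integral mu D (s_ n).
have Yx n : space Y (x_ n) by exact: space_simple_integral (is_ n).
have [|g Yg xg] := cY x_ Yx.
  move=> e e0; have e20 : 0 < e / 2 by rewrite divr_gt0.
  have [N _ NP] := cvge0_near_le e20 us; exists N => m n Nm Nn.
  rewrite -lee_fin (le_trans (nrm_simple_integralB_le mD sY mu_ (is_ m) (is_ n))) //.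
  by rewrite (splitr e) EFinD; apply: leeD; exact: NP.
exists g; first by split => //; exists s_; split.
apply/lee_addgt0Pr => e e0; have e20 : 0 < e / 2 by rewrite divr_gt0.
near \oo => n.
have le1 : (\int[mu]_(t in D) (nrm Y (u t - s_ n t))%:E <= (e / 2)%:E)%E.
  by near: n; exact: cvge0_near_le.
have le2 : nrm Y (x_ n - g) <= e / 2.
  near: n; have /cvgrPdist_le /(_ _ e20) := xg; apply: filterS => n.
  by rewrite sub0r normrN ger0_norm // nrm_ge0.
have le3 : nrm Y g <= nrm Y (x_ n - g) + nrm Y (x_ n).
  rewrite (nrm_distrC sY) // -{1}(subrK (x_ n) g).
  by apply: ler_nrmD => //; exact: spaceB.
rewrite (splitr e) EFinD addeCA.
apply: (@le_trans _ _ ((nrm Y (x_ n - g))%:E + (nrm Y (x_ n))%:E)%E).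
  by rewrite -EFinD lee_fin.
apply: leeD; first by rewrite lee_fin.
apply: le_trans (nrm_simple_integral_le mD sY mu_ (is_ n)) _.
by rewrite addeC leeD2l.
Unshelve. all: by end_near. Qed.

Lemma integrable_simpleS D E Y s : measurable D -> measurable E -> E `<=` D ->
  integrable_simple_on mu D Y s -> integrable_simple_on mu E Y s.
Proof.
move=> mD mE ED /(integrable_simple_onP _ _ _ mD)[fs Ys fins].
apply/integrable_simple_onP => //; split; [exact: fin_measS fs|by auto|].
move=> z [t Et stz] z0; apply: le_lt_trans (fins z _ z0); last first.
  by exists t => //; exact: ED.
have fsE := fin_measS mE ED fs.
rewrite le_measure ?inE //; [exact: fsE.2|exact: fs.2|].
by apply: setSI.
Qed.

(** The integral over [E] may be taken in a smaller space [Y'] with a stronger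
    norm: there the simple functions [h_ n] approximating in [Y'] have integrals
    close to [g], and in [Y] they are close to those of the restrictions to [E] of
    the functions [s_ n] approximating over [D]. *)
Lemma is_bochner_integralB D E Y Y' w f g :
  measurable D -> measurable E -> E `<=` D ->
  seminormed Y -> seminormed Y' -> space Y' `<=` space Y ->
  (forall x, space Y' x -> nrm Y x <= nrm Y' x) ->
  is_bochner_integral mu D Y w f -> is_bochner_integral mu E Y' w g ->
  is_bochner_integral mu (D `\` E) Y w (f - g).
Proof.
move=> mD mE ED sY sY' YY' nYY' [mw Yf [s_ [is_ ws sf]]] [mw' Yg [h_ [ih wh hg]]].
have mDE : measurable (D `\` E) by exact: measurableD.
have DED : D `\` E `<=` D by move=> t [].
have mwE := strongly_measurableS mD mE ED mw.
have Yw : forall t, D t -> space Y (w t) by case: mw.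
have ihY n : integrable_simple_on mu E Y (h_ n).
  have /(integrable_simple_onP _ _ _ mE)[fh Yh finh] := ih n.
  by apply/integrable_simple_onP => //; split => // t Et; apply/YY'/Yh.
have isE n := integrable_simpleS mD mE ED (is_ n).
have isDE n := integrable_simpleS mD mDE DED (is_ n).
have mwsD n : measurable_fun D (fun t => (nrm Y (w t - s_ n t))%:E).
  apply/measurable_EFinP; apply: measurable_nrmB mw _ => //.
  exact: integrable_simple_strongly_measurable.
have le_sub A n : measurable A -> A `<=` D ->
    (\int[mu]_(t in A) (nrm Y (w t - s_ n t))%:E <=
     \int[mu]_(t in D) (nrm Y (w t - s_ n t))%:E)%E.
  move=> mA AD; apply: ge0_subset_integral => // t _.
  by rewrite lee_fin nrm_ge0.
split.
- exact: strongly_measurableS mw.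
- by apply: spaceB => //; exact: YY'.
exists s_; split => //.
  apply: cvge0_le ws => n; rewrite le_sub // andbT.
  by apply: integral_ge0 => t _; rewrite lee_fin nrm_ge0.
have Yis n := space_simple_integral sY mD (is_ n).
have YisE n := space_simple_integral sY mE (isE n).
have Yih n := space_simple_integral sY mE (ihY n).
have Yih' n := space_simple_integral sY' mE (ih n).
have eqI n : simple_integral mu (D `\` E) (s_ n) - (f - g) =
   (simple_integral mu D (s_ n) - f) +
   ((g - simple_integral mu E (h_ n)) +
    (simple_integral mu E (h_ n) - simple_integral mu E (s_ n))).
  have [fs _ fins] := (integrable_simple_onP mu Y (s_ n) mD).1 (is_ n).
  have split_s : simple_integral mu D (s_ n) =
      simple_integral mu (D `\` E) (s_ n) + simple_integral mu E (s_ n).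
    have cut A : measurable A -> A `<=` D ->
        fin_meas D (fun t => if t \in A then s_ n t else 0) /\
        fin_fibers mu D (fun t => if t \in A then s_ n t else 0) idfun.
      move=> mA AD; have fA := fin_meas_cut mD mA AD (fin_measS mA AD fs).
      split => // z [t Dt stz] z0; apply: le_lt_trans (fins z _ z0).
        rewrite le_measure ?inE //; [exact: fA.2|exact: fs.2|].
        move=> x [Dx] /=; case: ifP => // _ z0'.
        by rewrite -z0' eqxx in z0.
      exists t => //; move: stz; case: ifP => // _ z0'.
      by rewrite -z0' eqxx in z0.
    have [f1 i1] := cut _ mDE DED; have [f2 i2] := cut _ mE ED.
    rewrite /simple_integral -[LHS]/(fiber_sum mu D (s_ n) idfun).
    rewrite -[X in _ = X + _](fiber_sum_cut mu (s_ n) DED).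
    rewrite -[X in _ = _ + X](fiber_sum_cut mu (s_ n) ED).
    rewrite -fiber_sum_funD //; apply: eq_fiber_sum => t Dt.
    have [Et|nEt] := pselect (E t).
      by rewrite (memNset (A := D `\` E)) ?mem_set ?add0r // => -[].
    by rewrite mem_set // memNset // addr0.
  rewrite split_s opprB.
  have -> b c : g - c + (c - b) = g - b by rewrite addrA subrK.
  move: (simple_integral mu (D `\` E) _) (simple_integral mu E _) => a b.
  by rewrite [g - b]addrC (addrA (a + b - f)) [a + b - f - b]addrAC addrK
    -addrA [- f + g]addrC.
apply: (@cvg0_le R _ (fun n => nrm Y (simple_integral mu D (s_ n) - f) +
   (nrm Y' (simple_integral mu E (h_ n) - g) +
    nrm Y (simple_integral mu E (s_ n) - simple_integral mu E (h_ n))))).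
  move=> n; rewrite nrm_ge0 //= eqI.
  have Yg' := YY' _ Yg.
  apply: le_trans (ler_nrmD sY _ _) _.
  - by apply: spaceB.
  - by apply: spaceD => //; apply: spaceB.
  rewrite lerD2l; apply: le_trans (ler_nrmD sY _ _) _; try by apply: spaceB.
  apply: lerD; last by rewrite nrm_distrC.
  rewrite (nrm_distrC sY) //; apply: nYY'.
  by apply: spaceB.
rewrite -[X in _ --> X](addr0 0); apply: cvgD => //.
rewrite -[X in _ --> X](addr0 0); apply: cvgD => //.
suff : (nrm Y (simple_integral mu E (s_ n) - simple_integral mu E (h_ n)))%:E
    @[n --> \oo] --> 0%E by move=> /fine_cvgP[].
apply: (@cvge0_le R _ (fun n =>
   (\int[mu]_(t in D) (nrm Y (w t - s_ n t))%:E +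
    \int[mu]_(t in E) (nrm Y' (w t - h_ n t))%:E)%E)); last exact: cvge0D.
move=> n; rewrite lee_fin nrm_ge0 //=.
apply: le_trans (nrm_simple_integralB_le mE sY mwE (isE n) (ihY n)) _.
have Yw' : forall t, E t -> space Y' (w t) by case: mw'.
have /(integrable_simple_onP _ _ _ mE)[_ Yh' _] := ih n.
apply: leeD; first exact: le_sub.
apply: ge0_le_integral => //.
- by move=> t _; rewrite lee_fin nrm_ge0.
- apply/measurable_EFinP; apply: measurable_nrmB mwE _ => //.
  exact: integrable_simple_strongly_measurable.
- apply/measurable_EFinP; apply: measurable_nrmB mw' _ => //.
  exact: integrable_simple_strongly_measurable.
by move=> t Et; rewrite lee_fin nYY' //; apply: spaceB; auto.
Qed.

End bochner_integral.

Section bochner_integral_operations.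
Context d (T : measurableType d) (R : realType) (Z : lmodType R).
Variable mu : {measure set T -> \bar R}.
Implicit Types (D E : set T) (Y : normed_in Z) (u w : T -> Z).

(** As in [strongly_measurableP], the approximants may be plain functions. *)
Lemma ex_is_bochner_integral D Y u f (f_ : nat -> T -> Z) : measurable D ->
  strongly_measurable mu D Y u -> space Y f ->
  (forall n, fin_meas D (f_ n)) -> (forall n t, D t -> space Y (f_ n t)) ->
  (forall n, fin_fibers mu D (f_ n) idfun) ->
  (\int[mu]_(t in D) (nrm Y (u t - f_ n t))%:E)%E @[n --> \oo] --> 0%E ->
  nrm Y (fiber_sum mu D (f_ n) idfun - f) @[n --> \oo] --> (0 : R) ->
  is_bochner_integral mu D Y u f.
Proof.
move=> mD mu_ Yf fm Yf_ finf uf ff; split => //.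
have [s_ hs] := choice (fun n => ex_simple_on mD (fm n) (Yf_ n)).
exists s_; split.
- move=> n; split; first exact: (hs n).1.
  move=> z [t Dt stz] z0.
  have -> : D `&` s_ n @^-1` [set z] = D `&` f_ n @^-1` [set z].
    by apply/seteqP; split=> x [Dx] /=; rewrite (hs n).2.
  by apply: finf => //; exists t => //; rewrite -(hs n).2.
- rewrite [X in X @ \oo --> _](_ : _ =
    fun n => (\int[mu]_(t in D) (nrm Y (u t - f_ n t))%:E)%E) //.
  by apply/funext => n; apply: eq_integral => t /set_mem Dt; rewrite (hs n).2.
- rewrite [X in X @ \oo --> _](_ : _ =
    fun n => nrm Y (fiber_sum mu D (f_ n) idfun - f)) //.
  apply/funext => n; congr (nrm Y (_ - f)).
  by apply: eq_fiber_sum; exact: (hs n).2.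
Qed.

Lemma eq_is_bochner_integral D Y u w f : measurable D ->
  (forall t, D t -> u t = w t) ->
  is_bochner_integral mu D Y u f -> is_bochner_integral mu D Y w f.
Proof.
move=> mD uw [mu_ Yf [s_ [is_ us sf]]]; split => //.
  exact: eq_strongly_measurable mu_.
exists s_; split => //; rewrite [X in X @ \oo --> _](_ : _ =
  fun n => (\int[mu]_(t in D) (nrm Y (u t - s_ n t))%:E)%E) //.
by apply/funext => n; apply: eq_integral => t /set_mem Dt; rewrite uw.
Qed.

Lemma is_bochner_integral_cut D E Y u f : measurable D -> measurable E ->
  E `<=` D -> seminormed Y ->
  is_bochner_integral mu E Y u f ->
  is_bochner_integral mu D Y (fun t => if t \in E then u t else 0) f.
Proof.
move=> mD mE ED sY [mu_ Yf [s_ [is_ us sf]]].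
have is' n := (integrable_simple_onP mu Y (s_ n) mE).1 (is_ n).
apply: (ex_is_bochner_integral
  (f_ := fun n t => if t \in E then s_ n t else 0)) => //.
- exact: strongly_measurable_cut.
- by move=> n; apply: fin_meas_cut => //; case: (is' n).
- move=> n t Dt; case: ifPn => [/set_mem Et|_]; last exact: space0.
  by have [_ /(_ _ Et)] := is' n.
- move=> n z [t Dt /= stz] z0; have [_ _ fins] := is' n.
  rewrite (_ : _ `&` _ = E `&` s_ n @^-1` [set z]).
    apply: fins => //; move: stz; case: ifPn => [/set_mem Et stz|_ z0'].
      by exists t.
    by rewrite -z0' eqxx in z0.
  apply/seteqP; split=> [x [Dx] /=|x /= [Ex stx]].
    by case: ifPn => [/set_mem Ex ?|_ z0'] //; rewrite -z0' eqxx in z0.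
  by split; [exact: ED|rewrite mem_set].
- rewrite [X in X @ \oo --> _](_ : _ =
    fun n => (\int[mu]_(t in E) (nrm Y (u t - s_ n t))%:E)%E) //.
  apply/funext => n; rewrite integral_mkcond [RHS]integral_mkcond.
  apply: eq_integral => t _; rewrite !patchE.
  have [Et|nEt] := boolP (t \in E); first by rewrite mem_set //; exact/ED/set_mem.
  by rewrite subrr (nrm0 sY); case: ifP.
- rewrite [X in X @ \oo --> _](_ : _ =
    fun n => nrm Y (simple_integral mu E (s_ n) - f)) //.
  by apply/funext => n; rewrite fiber_sum_cut.
Qed.

Lemma is_bochner_integral_addcst D E Y u f (g : Z) : measurable D ->
  measurable E -> E `<=` D -> (mu E < +oo)%E -> seminormed Y -> space Y g ->
  is_bochner_integral mu D Y u f ->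
  is_bochner_integral mu D Y (fun t => u t + (if t \in E then g else 0))
    (f + fine (mu E) *: g).
Proof.
move=> mD mE ED Efin sY Yg [mu_ Yf [s_ [is_ us sf]]].
have is' n := (integrable_simple_onP mu Y (s_ n) mD).1 (is_ n).
have fg (A : set T) : measurable A -> fin_meas A (cst g).
  move=> mA; split; first by apply: sub_finite_set (finite_set1 g) => _ [t _ <-].
  move=> y; have [->|yg] := eqVneq y g.
    by rewrite (_ : _ `&` _ = A) //; apply/seteqP; split=> t // -[].
  rewrite (_ : _ `&` _ = set0) // -subset0 => t [_ /= /eqP].
  by rewrite eq_sym (negbTE yg).
pose v t := if t \in E then g else 0.
have fv : fin_meas D v := fin_meas_cut mD mE ED (fg E mE).
have Yv t : space Y (v t) by rewrite /v; case: ifP => // _; exact: space0.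
have finv : fin_fibers mu D v idfun.
  move=> z _ z0; apply: le_lt_trans Efin; rewrite le_measure ?inE //.
    exact: fv.2.
  move=> t [Dt]; rewrite /v /=; case: ifPn => [/set_mem //|_ z0'].
  by rewrite -z0' eqxx in z0.
have mv : strongly_measurable mu D Y v.
  by apply: strongly_measurable_fin_meas; [| |exact: fv|].
have finsv n : fin_meas D (fun t => s_ n t + v t).
  have [fs _ _] := is' n.
  exact: (fin_meas_comp (fun z => z.1 + z.2) (fin_meas_pair fs fv)).
apply: (ex_is_bochner_integral (f_ := fun n t => s_ n t + v t)) => //.
- exact: strongly_measurableD.
- by apply: spaceD => //; exact: spaceZ.
- by move=> n t Dt; apply: spaceD => //; have [_ Ys _] := is' n; exact: Ys.
- move=> n z [t Dt <-] z0; have [fs Ys fins] := is' n.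
  set A := D `&` s_ n @^-1` [set s_ n t + v t].
  have mA : measurable A by exact: fs.2.
  have Afin : (mu A < +oo)%E.
    have [A0|/set0P[x [Dx sx]]] := eqVneq A set0; first by rewrite A0 measure0.
    by apply: fins z0; exists x.
  apply: (@le_lt_trans _ _ (mu (A `|` E))).
    rewrite le_measure ?inE //; [exact: (finsv n).2|exact: measurableU|].
    move=> x [Dx] /=; rewrite {1}/v; case: ifPn => [/set_mem Ex _|_]; first by right.
    by rewrite addr0 => sx; left.
  by apply: le_lt_trans (measureU2 mu mA mE) _; rewrite lte_add_pinfty.
- rewrite [X in X @ \oo --> _](_ : _ =
    fun n => (\int[mu]_(t in D) (nrm Y (u t - s_ n t))%:E)%E) //.
  apply/funext => n; apply: eq_integral => t _.
  by rewrite opprD addrACA -/(v t) subrr addr0.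
- have Ev : fiber_sum mu D v idfun = fine (mu E) *: g.
    rewrite fiber_sum_cut // /fiber_sum.
    have [->|/set0P[t Et]] := eqVneq E set0.
      by rewrite image_set0 fsbig_set0 measure0 scale0r.
    rewrite (_ : _ @` E = [set g]); last first.
      by apply/seteqP; split=> [_ [x _ <-]|_ ->] //; exists t.
    rewrite fsbig_set1 (_ : E `&` _ = E) //.
    by apply/seteqP; split=> x // -[].
  rewrite [X in X @ \oo --> _](_ : _ =
    fun n => nrm Y (simple_integral mu D (s_ n) - f)) //.
  apply/funext => n; have [fs Ys fins] := is' n; rewrite fiber_sum_funD // Ev.
  by rewrite opprD addrACA subrr addr0.
Qed.

End bochner_integral_operations.

(** * Couples of seminormed subspaces *)

Lemma same_space_norms (R : realType) (Z : lmodType R) (S : set Z)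
    (N N' : Z -> \bar R) (c c' : R) : 0 < c -> 0 < c' ->
  (forall f, 0 <= N f)%E -> (forall f, 0 <= N' f)%E ->
  (forall f, S f -> N f <= c%:E * N' f)%E ->
  (forall f, S f -> N' f <= c'%:E * N f)%E ->
  same_space (NormedIn [set f | S f /\ (N f < +oo)%E] (fun f => fine (N f)))
             (NormedIn [set f | S f /\ (N' f < +oo)%E] (fun f => fine (N' f))).
Proof.
move=> c0 c'0 N0 N'0 NN' N'N.
have lty (M M' : Z -> \bar R) (k : R) f : 0 < k -> (0 <= M' f)%E ->
    (M f <= k%:E * M' f)%E -> (M' f < +oo)%E -> (M f < +oo)%E.
  move=> k0 M'0 le M'f; apply: le_lt_trans le _.
  by rewrite lte_mul_pinfty // lee_fin ltW.
split => /=.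
  apply/seteqP; split=> f [Sf fin]; split => //.
    exact: (lty _ _ _ _ c'0 (N0 f) (N'N f Sf) fin).
  exact: (lty _ _ _ _ c0 (N'0 f) (NN' f Sf) fin).
exists c, c'; split => // f [Sf Nf].
have N'f := lty _ _ _ _ c'0 (N0 f) (N'N f Sf) Nf.
have finN : N f \is a fin_num by rewrite ge0_fin_numE.
have finN' : N' f \is a fin_num by rewrite ge0_fin_numE.
by rewrite -!lee_fin !EFinM !fineK //; split; auto.
Qed.

Section couples.
Context (R : realType) (Z : lmodType R).
Implicit Types Y : normed_in Z.

Lemma embedded_nrm (X : normedModType R) (i : {linear X -> Z}) x :
  injective i -> nrm (embedded i) (i x) = `|x|.
Proof.
move=> ij /=; congr `|_|; apply: xget_unique => //= y; exact: ij.
Qed.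

Lemma embedded_seminormed (X : normedModType R) (i : {linear X -> Z}) :
  injective i -> seminormed (embedded i).
Proof.
move=> ij; split.
- by exists 0 => //; rewrite linear0.
- by move=> _ _ [x _ <-] [y _ <-]; exists (x + y); rewrite ?linearD.
- by move=> c _ [x _ <-]; exists (c *: x); rewrite ?linearZ.
- by move=> x; exact: normr_ge0.
- move=> _ _ [x _ <-] [y _ <-].
  have := embedded_nrm (x + y) ij; rewrite linearD => ->.
  by rewrite !(embedded_nrm _ ij) ler_normD.
- move=> c _ [x _ <-].
  have := embedded_nrm (c *: x) ij; rewrite linearZ => ->.
  by rewrite (embedded_nrm _ ij) normrZ.
Qed.

Lemma capS_seminormed Y0 Y1 : seminormed Y0 -> seminormed Y1 ->
  seminormed (capS Y0 Y1).
Proof.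
move=> s0 s1; split => /=.
- by split; exact: space0.
- by move=> x y [? ?] [? ?]; split; exact: spaceD.
- by move=> c x [? ?]; split; exact: spaceZ.
- by move=> x; rewrite le_max nrm_ge0.
- move=> x y [x0 x1] [y0 y1]; rewrite ge_max; apply/andP; split.
    by apply: le_trans (ler_nrmD s0 x0 y0) _; apply: lerD; rewrite le_max lexx.
  by apply: le_trans (ler_nrmD s1 x1 y1) _; apply: lerD; rewrite le_max lexx orbT.
- move=> c x [x0 x1]; rewrite ge_max; apply/andP; split.
    by apply: le_trans (ler_nrmZ s0 c x0) _; rewrite ler_wpM2l // le_max lexx.
  by apply: le_trans (ler_nrmZ s1 c x1) _; rewrite ler_wpM2l // le_max lexx orbT.
Qed.

(** The norm of the sum is the K-functional at [1], so that its properties are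
    special cases. *)
Lemma sumS_nrmE Y0 Y1 f : nrm (sumS Y0 Y1) f = Kfun Y0 Y1 f 1.
Proof.
rewrite /= /Kfun; congr inf; apply/seteqP.
by split=> _ [f0 [f1 [? ? ? ->]]]; exists f0, f1; rewrite mul1r.
Qed.

Section Kfunctional.
Variables Y0 Y1 : normed_in Z.
Hypotheses (s0 : seminormed Y0) (s1 : seminormed Y1).

Lemma Kfun_le f f0 f1 t : 0 <= t -> space Y0 f0 -> space Y1 f1 ->
  f = f0 + f1 -> Kfun Y0 Y1 f t <= nrm Y0 f0 + t * nrm Y1 f1.
Proof.
move=> t0 Yf0 Yf1 ff; apply: ge_inf; last by exists f0, f1.
exists 0 => _ [g0 [g1 [_ _ _ ->]]].
by rewrite addr_ge0 ?mulr_ge0 ?nrm_ge0.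
Qed.

Lemma Kfun_ge f t (r : R) : space (sumS Y0 Y1) f ->
  (forall f0 f1, space Y0 f0 -> space Y1 f1 -> f = f0 + f1 ->
     r <= nrm Y0 f0 + t * nrm Y1 f1) ->
  r <= Kfun Y0 Y1 f t.
Proof.
move=> [f0 [f1 [Yf0 Yf1 ff]]] rle; apply: lb_le_inf.
  by exists (nrm Y0 f0 + t * nrm Y1 f1), f0, f1.
by move=> _ [g0 [g1 [Yg0 Yg1 fg ->]]]; exact: rle.
Qed.

Lemma Kfun_ge0 f t : 0 <= t -> 0 <= Kfun Y0 Y1 f t.
Proof.
move=> t0; have [Sf|nSf] := pselect (space (sumS Y0 Y1) f).
  apply: Kfun_ge => // f0 f1 _ _ _.
  by rewrite addr_ge0 ?mulr_ge0 ?nrm_ge0.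
rewrite /Kfun (_ : [set _ | _] = set0) ?inf0 // -subset0 => r [f0 [f1 [? ? ? _]]].
by apply: nSf; exists f0, f1.
Qed.

Lemma Kfun_homo f t t' : 0 <= t -> t <= t' -> space (sumS Y0 Y1) f ->
  Kfun Y0 Y1 f t <= Kfun Y0 Y1 f t'.
Proof.
move=> t0 tt' Sf; apply: Kfun_ge => // f0 f1 Yf0 Yf1 ff.
apply: le_trans (Kfun_le t0 Yf0 Yf1 ff) _.
by rewrite lerD2l ler_wpM2r ?nrm_ge0.
Qed.

Lemma sumS_seminormed : seminormed (sumS Y0 Y1).
Proof.
split.
- by exists 0, 0; split; [exact: space0|exact: space0|rewrite addr0].
- move=> _ _ [x0 [x1 [? ? ->]]] [y0 [y1 [? ? ->]]].
  by exists (x0 + y0), (x1 + y1); split; [exact: spaceD|exact: spaceD|rewrite addrACA].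
- move=> c _ [x0 [x1 [? ? ->]]].
  by exists (c *: x0), (c *: x1); split; [exact: spaceZ|exact: spaceZ|rewrite scalerDr].
- by move=> x; rewrite sumS_nrmE; exact: Kfun_ge0.
- move=> x y Sx Sy; rewrite !sumS_nrmE -lerBlDr.
  apply: Kfun_ge => // x0 x1 Yx0 Yx1 xx; rewrite mul1r lerBlDr -lerBlDl.
  apply: Kfun_ge => // y0 y1 Yy0 Yy1 yy; rewrite mul1r lerBlDl.
  apply: le_trans (@Kfun_le _ (x0 + y0) (x1 + y1) _ _ _ _ _) _ => //.
  + exact: spaceD.
  + exact: spaceD.
  + by rewrite xx yy addrACA.
  by rewrite mul1r addrACA; apply: lerD; exact: ler_nrmD.
- move=> c x Sx; rewrite !sumS_nrmE.
  have [->|c0] := eqVneq c 0.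
    rewrite scale0r normr0 mul0r.
    apply: le_trans (@Kfun_le _ 0 0 _ _ _ _ _) _ => //; try exact: space0.
      by rewrite addr0.
    by rewrite !nrm0 // mulr0 addr0.
  rewrite mulrC -ler_pdivrMr ?normr_gt0 //.
  apply: Kfun_ge => // x0 x1 Yx0 Yx1 xx; rewrite ler_pdivrMr ?normr_gt0 //.
  apply: le_trans (@Kfun_le _ (c *: x0) (c *: x1) _ _ _ _ _) _ => //.
  + exact: spaceZ.
  + exact: spaceZ.
  + by rewrite xx scalerDr.
  by rewrite !mul1r mulrDl ![_ * `|c|]mulrC; apply: lerD; exact: ler_nrmZ.
Qed.

Lemma capS_subset_sumS : space (capS Y0 Y1) `<=` space (sumS Y0 Y1).
Proof.
move=> x [x0 x1]; exists x, 0; split => //; first exact: space0.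
by rewrite addr0.
Qed.

Lemma sumS_nrm_le_capS x : space (capS Y0 Y1) x ->
  nrm (sumS Y0 Y1) x <= nrm (capS Y0 Y1) x.
Proof.
move=> [x0 x1]; rewrite sumS_nrmE.
apply: le_trans (@Kfun_le _ x 0 _ _ x0 (space0 s1) _) _ => //; first by rewrite addr0.
by rewrite nrm0 // mulr0 addr0 /= le_max lexx.
Qed.

End Kfunctional.

(** Thus completeness of the intersection of the couple [(Y0, capS Y0 Y1)] is
    that of [capS Y0 Y1]. *)
Lemma capS_capS Y0 Y1 : capS Y0 (capS Y0 Y1) = capS Y0 Y1.
Proof.
rewrite /capS /=; congr NormedIn; first by rewrite setIA setIid.
by apply/funext => f; rewrite maxA maxxx.
Qed.

End couples.

(** A Cauchy sequence of the intersection converges in both spaces, hence in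
    [Z], where the two limits coincide. *)
Lemma capS_complete (R : realType) (Z : topologicalLmodType R)
    (X0 X1 : completeNormedModType R)
    (i0 : {linear X0 -> Z}) (i1 : {linear X1 -> Z}) :
  compatible_couple i0 i1 -> complete_in (capS (embedded i0) (embedded i1)).
Proof.
move=> [hZ inj0 c0 inj1 c1] z_ Yz cz.
have ex0 n : exists x, i0 x = z_ n by have [[x _ <-] _] := Yz n; exists x.
have ex1 n : exists y, i1 y = z_ n by have [_ [y _ <-]] := Yz n; exists y.
have [[x_ hx] [y_ hy]] := (choice ex0, choice ex1).
have nx m n : nrm (embedded i0) (z_ m - z_ n) = `|x_ m - x_ n|.
  by rewrite -(embedded_nrm _ inj0) linearB !hx.
have ny m n : nrm (embedded i1) (z_ m - z_ n) = `|y_ m - y_ n|.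
  by rewrite -(embedded_nrm _ inj1) linearB !hy.
have cauchy_cv (X : completeNormedModType R) (v : nat -> X) :
    (forall e : R, 0 < e -> exists N, forall m n, (N <= m)%N -> (N <= n)%N ->
       `|v m - v n| <= e) -> exists x : X, v n @[n --> \oo] --> x.
  move=> cv; suff : cvg (v @ \oo) by move=> vc; exists (lim (v @ \oo)).
  apply/cauchy_cvgP/cauchy_exP => e e0.
  have e20 : 0 < e / 2 by rewrite divr_gt0.
  have [N NP] := cv _ e20; exists (v N); exists N => // n /= Nn.
  rewrite -ball_normE /ball_ /=; apply: le_lt_trans (NP N n _ Nn) _ => //.
  by rewrite ltr_pdivrMr // ltr_pMr // ltr1n.
have le_cap x : nrm (embedded i0) x <= nrm (capS (embedded i0) (embedded i1)) x /\
    nrm (embedded i1) x <= nrm (capS (embedded i0) (embedded i1)) x.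
  by rewrite /= !le_max !lexx orbT.
have [x xc] : exists x : X0, x_ n @[n --> \oo] --> x.
  apply: cauchy_cv => e e0; have [N NP] := cz e e0; exists N => m n Nm Nn.
  by rewrite -nx (le_trans (le_cap _).1) // NP.
have [y yc] : exists y : X1, y_ n @[n --> \oo] --> y.
  apply: cauchy_cv => e e0; have [N NP] := cz e e0; exists N => m n Nm Nn.
  by rewrite -ny (le_trans (le_cap _).2) // NP.
have xy : i0 x = i1 y.
  have z0 : z_ n @[n --> \oo] --> i0 x.
    rewrite (_ : z_ = i0 \o x_); last by apply/funext => n /=; rewrite hx.
    by apply: cvg_comp xc _; exact: c0.
  have z1 : z_ n @[n --> \oo] --> i1 y.
    rewrite (_ : z_ = i1 \o y_); last by apply/funext => n /=; rewrite hy.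
    by apply: cvg_comp yc _; exact: c1.
  exact: (cvg_unique hZ z0 z1).
exists (i0 x); first by split; [exists x|rewrite xy; exists y].
have -> : (fun n => nrm (capS (embedded i0) (embedded i1)) (z_ n - i0 x)) =
    fun n => Num.max `|x_ n - x| `|y_ n - y|.
  apply/funext => n ; congr Num.max.
    by rewrite -(embedded_nrm _ inj0) linearB hx.
  by rewrite -(embedded_nrm _ inj1) linearB hy xy.
apply: (@cvg0_le R _ (fun n => `|x_ n - x| + `|y_ n - y|)).
  by move=> n; rewrite le_max normr_ge0 ge_max lerDl lerDr !normr_ge0.
rewrite -[X in _ --> X](addr0 0); apply: cvgD.
  by apply/norm_cvg0P/subr_cvg0.
by apply/norm_cvg0P/subr_cvg0.
Qed.

(** * Lebesgue measurable sets and functions *)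

Section lebesgue_facts.
Context {R : realType}.
Notation L := (lebesgueType R).

Lemma borel_lebesgue_measurable (B : set R) :
  measurable (B : set (measurableTypeR R)) -> measurable (B : set L).
Proof. exact: sub_caratheodory. Qed.

Lemma measurable_lebesgue_itv (i : interval R) : measurable ([set` i] : set L).
Proof. by apply: borel_lebesgue_measurable; exact: measurable_itv. Qed.

Lemma borel_lebesgue_measurable_fun (D E : set R) (f : R -> R) :
  measurable (D : set L) -> measurable (E : set (measurableTypeR R)) ->
  D `<=` E -> measurable_fun (E : set (measurableTypeR R)) f ->
  measurable_fun (D : set L) (f : L -> R).
Proof.
move=> mD mE DE mf _ B mB; rewrite (_ : _ `&` _ = D `&` (E `&` f @^-1` B)).
  by apply: measurableI => //; apply: borel_lebesgue_measurable; exact: mf.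
by rewrite setIA (setIidl DE).
Qed.

Lemma measurable_lebesgue_powR (D : set L) (p : R) : measurable D ->
  measurable_fun D (fun t : L => (t : R) `^ p).
Proof.
move=> mD; apply: (borel_lebesgue_measurable_fun (E := setT)) => //.
Qed.

Lemma measurable_lebesgue_inv (D : set L) : measurable D ->
  D `<=` `]0, +oo[%classic -> measurable_fun D (fun t : L => (t : R)^-1).
Proof.
move=> mD D0; apply: (eq_measurable_fun (fun t : L => (t : R) `^ (-1))).
  move=> t /set_mem /D0 /=; rewrite in_itv /= andbT => t0.
  by rewrite powR_inv1 // ltW.
exact: measurable_lebesgue_powR.
Qed.

Lemma lebE (B : set R) : leb (B : set L) = lebesgue_measure B.
Proof. by []. Qed.

Lemma lebesgue_setT_gt0 : (0 < leb [set: lebesgueType R])%E.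
Proof.
rewrite (_ : leb _ = lebesgue_measure [set: R]) //.
by rewrite -set_itvNyy lebesgue_measure_itv /= ltry.
Qed.

Lemma lebesgue_itv_oo (a b : R) : a <= b ->
  leb (`]a, b[%classic : set L) = (b - a)%:E.
Proof.
move=> ab; rewrite lebE lebesgue_measure_itv /= lte_fin -EFinD.
by case: ltgtP ab => // -> _; rewrite subrr.
Qed.

End lebesgue_facts.

(** * Weighted Lebesgue norms *)

Section Lnorms.
Context d (T : measurableType d) (R : realType).
Variable mu : {measure set T -> \bar R}.
Implicit Types (f g : T -> R) (q : \bar R).
Local Open Scope ereal_scope.

Lemma LnormEr f (r : R) :
  'N[mu]_(r%:E)[EFin \o f] = (\int[mu]_t (`|f t| `^ r)%:E) `^ r^-1.
Proof. by rewrite unlock. Qed.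

Lemma measurable_norm_powR f (r : R) : measurable_fun setT f ->
  measurable_fun setT (fun t => (`|f t| `^ r)%:E).
Proof.
move=> mf; apply/measurable_EFinP.
apply: (measurableT_comp (measurable_powR r)); exact: measurableT_comp.
Qed.

Lemma le_Lnorm f g q : measurable_fun setT f -> measurable_fun setT g -> 0 < q ->
  (forall t, `|f t| <= `|g t|)%R -> 'N[mu]_q[EFin \o f] <= 'N[mu]_q[EFin \o g].
Proof.
move=> mf mg; case: q => [r|_|//]; last first.
  move=> fg; rewrite unlock /Lnorm; case: ifP => // _.
  by apply: le_ess_sup; apply/aeW => t /=; rewrite lee_fin.
rewrite lte_fin => r0 fg; rewrite !LnormEr.
have int0 h : 0 <= \int[mu]_t (`|h t| `^ r)%:E.
  by apply: integral_ge0 => t _; rewrite lee_fin powR_ge0.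
apply: gt0_ler_poweR; rewrite ?in_itv /= ?leey ?andbT //.
  by rewrite invr_ge0 ltW.
apply: ge0_le_integral => //; try exact: measurable_norm_powR.
by move=> t _; rewrite lee_fin ge0_ler_powR ?nnegrE //; exact: ltW.
Qed.

Lemma Lnorm_scale f q (c : R) : measurable_fun setT f -> 0 < q -> (0 <= c)%R ->
  'N[mu]_q[EFin \o (fun t => (c * f t)%R)] = c%:E * 'N[mu]_q[EFin \o f].
Proof.
move=> mf; case: q => [r|_|//]; last first.
  move=> c0; rewrite unlock /Lnorm; case: ifPn => [muT|_]; last by rewrite mule0.
  rewrite -ess_supZl //; congr ess_sup; apply/funext => t /=.
  by rewrite normrM (ger0_norm c0) EFinM.
rewrite lte_fin => r0 c0; rewrite !LnormEr.
under eq_integral => t _ do rewrite normrM (ger0_norm c0) powRM // EFinM.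
rewrite ge0_integralZl //; last 2 first.
- exact: measurable_norm_powR.
- by rewrite lee_fin powR_ge0.
rewrite poweRM ?lee_fin ?powR_ge0 //.
  by rewrite poweR_EFin -powRrM mulfV ?gt_eqF // powRr1.
by apply: integral_ge0 => t _; rewrite lee_fin powR_ge0.
Qed.

(** At the exponent [+oo] the first factor is almost everywhere bounded by its
    norm. *)
Lemma hoelder_ereal f g q (q' : R) : 0 < mu [set: T] ->
  measurable_fun setT f -> measurable_fun setT g ->
  1 < q -> q' = fine (hoelder_conjugate q) ->
  'N[mu]_q[EFin \o f] < +oo ->
  \int[mu]_t (`|f t * g t|)%:E <= 'N[mu]_q[EFin \o f] * 'N[mu]_(q'%:E)[EFin \o g].
Proof.
move=> muT mf mg; case: q => [r|_|//]; last first.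
  rewrite hoelder_conjugatey /= => ->.
  rewrite Lnorm1 unlock /Lnorm muT => Nfin.
  set N := ess_sup _ _ in Nfin *.
  have N0 : 0 <= N by apply: ess_sup_gee => //; apply/aeW => t /=.
  have Nfn : N \is a fin_num by rewrite ge0_fin_numE.
  under [X in _ <= _ * X]eq_integral => t _ do rewrite /=.
  rewrite -(fineK Nfn) -ge0_integralZl //; last 2 first.
    by apply/measurable_EFinP; exact: measurableT_comp.
    by rewrite lee_fin fine_ge0.
  apply: ae_ge0_le_integral => //.
  - by apply/measurable_EFinP; apply: measurableT_comp => //; exact: measurable_funM.
  - by move=> t _; rewrite mule_ge0 // lee_fin fine_ge0.
  - apply: measurable_funeM; apply/measurable_EFinP; exact: measurableT_comp.
  apply: filterS (ess_sup_ge mu (abse \o (EFin \o f))) => t /= ft _.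
  by rewrite normrM EFinM lee_wpmul2r // fineK.
rewrite lte_fin => r1 q'E _.
have r0 : (0 < r)%R by rewrite (lt_trans ltr01).
have rq' : (r^-1 + q'^-1 = 1)%R.
  rewrite q'E /hoelder_conjugate /= gt_eqF // -EFinB inver.
  by rewrite subr_eq0 gt_eqF //= invfM invrK mulrC mulrBl mul1r mulfV ?gt_eqF // addrC subrK.
have q'0 : (0 < q')%R.
  by rewrite -invr_gt0 -(ltrD2l r^-1) addr0 rq' invf_lt1.
have := hoelder mu mf mg r0 q'0 rq'.
by rewrite Lnorm1.
Qed.

End Lnorms.

Lemma Lnorm_bounded_lty d (T : measurableType d) (R : realType)
    (mu : {measure set T -> \bar R}) (f : T -> R) (E : set T) (M : R) (q : \bar R) :
  measurable E -> (mu E < +oo)%E -> measurable_fun setT f -> (0 < q)%E ->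
  (forall t, `|f t| <= M * \1_E t) -> ('N[mu]_q[EFin \o f] < +oo)%E.
Proof.
move=> mE Efin mf q0 fM.
have mM : measurable_fun setT (fun t => `|M| * \1_E t : R).
  by apply: measurable_funM; [exact: measurable_cst|exact: measurable_indic].
have le1 : ('N[mu]_q[EFin \o f] <= 'N[mu]_q[EFin \o (fun t => `|M| * \1_E t)%R])%E.
  apply: le_Lnorm => // t; apply: le_trans (fM t) _.
  by rewrite normrM normr_id [X in _ <= _ * X]ger0_norm ?ler_wpM2r ?ler_norm ?indicE.
apply: le_lt_trans le1 _.
rewrite Lnorm_scale //.
apply: lte_mul_pinfty => //.
case: q q0 => [r|_|//]; last first.
  rewrite unlock /Lnorm; case: ifP => // muT; apply: (@le_lt_trans _ _ 1%E); last exact: ltry.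
  by apply/ess_supP/aeW => t /=; rewrite lee_fin indicE; case: (t \in E); rewrite ?normr1 ?normr0.
rewrite lte_fin => r0; rewrite LnormEr poweR_lty //.
rewrite (eq_integral (fun t => (\1_E t)%:E)); last first.
  move=> t _; rewrite indicE; case: (t \in E); rewrite ?normr1 ?normr0 ?powR1 ?powR0 ?gt_eqF //.
by rewrite integral_indic // setIT.
Qed.

Lemma Lnorm_gt0 d (T : measurableType d) (R : realType)
    (mu : {measure set T -> \bar R}) (f : T -> R) (D : set T) (q : \bar R) :
  measurable D -> (0 < mu D)%E -> measurable_fun setT f -> (0 < q)%E ->
  (forall t, D t -> f t != 0) -> (0 < 'N[mu]_q[EFin \o f])%E.
Proof.
move=> mD D0 mf q0 f0; rewrite lt_neqAle Lnorm_ge0 andbT eq_sym.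
apply/eqP => /Lnorm_eq0_eq0 h.
have [|//|N [mN N0 fN]] := h; first exact/measurable_EFinP.
have : (mu D <= mu N)%E.
  rewrite le_measure ?inE // => t Dt; apply: fN => /= ft.
  have := f0 t Dt; have := ft Logic.I; move=> [] ->.
  by rewrite eqxx.
by rewrite N0 leNgt D0.
Qed.


(** * Densities against powers of their primitives *)

Lemma ge0_integral_bigcup_le d (T : measurableType d) (R : realType)
    (mu : {measure set T -> \bar R}) (F : nat -> set T) (f : T -> \bar R)
    (c : \bar R) : nondecreasing_seq F -> (forall n, measurable (F n)) ->
  (forall n, measurable_fun (F n) f) -> (forall n t, F n t -> (0 <= f t)%E) ->
  (forall n, (\int[mu]_(t in F n) f t <= c)%E) ->
  (\int[mu]_(t in \bigcup_n F n) f t <= c)%E.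
Proof.
move=> ndF mF mf f0 fc.
have cv : (\int[mu]_(t in F n) f t)%E @[n --> \oo] --> (\int[mu]_(t in \bigcup_n F n) f t)%E.
  exact: ge0_nondecreasing_set_cvg_integral.
rewrite -(cvg_lim _ cv) //; apply: lime_le; first by apply/cvg_ex; eexists; exact: cv.
by apply: nearW.
Qed.

Section primitive.
Context {R : realType}.
Notation L := (lebesgueType R).
Variables (w W : R -> R).
Hypotheses (mw : measurable_fun (`]0, +oo[%classic : set L) w)
  (w0 : forall t, 0 < t -> 0 <= w t)
  (WE : forall x, 0 < x ->
    (\int[leb]_(t in (`]0%R, x[%classic : set L)) (w t)%:E = (W x)%:E)%E)
  (W1 : 0 < W 1).

Let mI (i : interval R) : measurable ([set` i] : set L).
Proof. exact: measurable_lebesgue_itv. Qed.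

Let mwS (D : set L) : measurable D -> D `<=` `]0, +oo[%classic ->
  measurable_fun D (EFin \o w).
Proof. by move=> mD D0; apply/measurable_EFinP; apply: measurable_funS mw. Qed.

Lemma primitive_homo x y : 0 < x -> x <= y -> W x <= W y.
Proof.
move=> x0 xy; have y0 := lt_le_trans x0 xy.
rewrite -lee_fin -(WE x0) -(WE y0).
apply: (ge0_subset_integral leb (mI _) (mI _)).
- by apply: (mwS (mI _)) => t /=; rewrite !in_itv /= => /andP[->].
- by move=> t /=; rewrite in_itv /= lee_fin => /andP[/w0].
- by move=> t /=; rewrite !in_itv /= => /andP[-> /lt_le_trans]; apply.
Qed.

Lemma primitive_ge0 x : 0 < x -> 0 <= W x.
Proof.
move=> x0; rewrite -lee_fin -WE //; apply: integral_ge0 => t /=.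
by rewrite in_itv /= lee_fin => /andP[/w0].
Qed.

Lemma measurable_primitive (D : set L) : measurable D ->
  D `<=` `]0, +oo[%classic -> measurable_fun D W.
Proof.
move=> mD D0; apply: (eq_measurable_fun (fun x : L => if (0 : R) < x then W x else 0)).
  by move=> x /set_mem /D0 /=; rewrite in_itv /= andbT => ->.
apply: (borel_lebesgue_measurable_fun (E := setT)) => //.
apply: nondecreasing_measurable => // x y xy.
case: ifPn => x0; case: ifPn => y0 //.
- exact: primitive_homo.
- by rewrite (lt_le_trans x0 xy) in y0.
- exact: primitive_ge0.
Qed.

Definition sublevel (c : R) : set R := [set t | 0 < t /\ W t < c].

(** The sublevel sets of a primitive are initial intervals, up to an end point;
    hence the mass of the density below level [c] is at most [c]. *)
Lemma integral_sublevel_le (c : R) : 0 <= c ->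
  (\int[leb]_(t in (sublevel c : set L)) (w t)%:E <= c%:E)%E.
Proof.
move=> c0; set F : set L := sublevel c.
have mF : measurable F.
  rewrite (_ : F = `]0, +oo[%classic `&` W @^-1` `]-oo, c[%classic).
    exact: (measurable_primitive (mI _) (@subset_refl _ _) (mI _)
      (measurable_itv _)).
  by apply/seteqP; split=> t /=; rewrite !in_itv /= ?andbT.
have F0 : F `<=` `]0, +oo[%classic.
  by move=> t [t0 _]; rewrite /= in_itv /= t0.
have below x t : 0 < x -> x <= t -> F t ->
    (\int[leb]_(t in (`]0%R, x[%classic : set L)) (w t)%:E <= c%:E)%E.
  move=> x0 xt [_ Wt]; rewrite WE // lee_fin.
  by rewrite (le_trans (primitive_homo x0 xt)) // ltW.
have [->|/set0P[t0 Ft0]] := eqVneq F set0; first by rewrite integral_set0 lee_fin.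
(* an increasing sequence of initial intervals with end points below points
   of the sublevel set *)
suff [b [ndb bF [N [mN N0 FN]]]] : exists b : nat -> R,
    [/\ {homo b : m n / (m <= n)%N >-> m <= n},
        forall n, exists2 t, F t & b n <= t &
        exists N : set L, [/\ measurable N, leb N = 0 &
          F `<=` (\bigcup_n `]0, b n[%classic) `|` N]].
  pose U : set L := \bigcup_n `]0, b n[%classic.
  have mU : measurable U.
    by apply: bigcupT_measurable.
  have U0 : U `<=` `]0, +oo[%classic.
    by move=> t [n _] /=; rewrite !in_itv /= => /andP[->].
  pose N' : set L := (N `&` `]0, +oo[%classic) `\` U.
  have mN' : measurable N' by apply: measurableD => //; exact: measurableI.
  have N'0 : leb N' = 0.
    by apply: (subset_measure0 mN' mN _ N0) => t [[]].
  have UN0 : U `|` N' `<=` `]0, +oo[%classic.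
    by move=> t [/U0 //|[[_ ?] _]].
  apply: (@le_trans _ _ (\int[leb]_(t in U `|` N') (w t)%:E)%E).
    apply: (ge0_subset_integral leb mF (measurableU _ _ mU mN')).
    - exact: (mwS (measurableU _ _ mU mN') UN0).
    - by move=> t /UN0 /=; rewrite in_itv /= andbT lee_fin => /w0.
    - move=> t Ft; have [tU|tU] := pselect (U t).
        by left.
      right; split => //; split; last exact: F0.
      by have [] := FN t Ft.
  rewrite (ge0_integral_setU leb mU mN'); last 3 first.
  - exact: (mwS (measurableU _ _ mU mN') UN0).
  - by move=> t /UN0 /=; rewrite in_itv /= andbT lee_fin => /w0.
  - by apply/disj_setPS => t [tU [_ /(_ tU)]].
  have N'I : N' `<=` `]0, +oo[%classic by move=> t [[]].
  rewrite (null_set_integral mN' (mwS mN' N'I) N'0) adde0.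
  apply: (@ge0_integral_bigcup_le _ _ _ _ _ _ _ _ (fun n => mI _)).
  - move=> m n mn; apply/subsetPset => t /=; rewrite !in_itv /=.
    by move=> /andP[-> /lt_le_trans]; apply; exact: ndb.
  - by move=> n; apply: (mwS (mI _)) => t /=; rewrite !in_itv /= => /andP[->].
  - by move=> n t /=; rewrite in_itv /= lee_fin => /andP[/w0].
  move=> n; have [t Ft bt] := bF n.
  have [b0|b0] := ltP 0 (b n); first exact: below bt Ft.
  rewrite (_ : `]0, b n[%classic = set0) ?integral_set0 ?lee_fin //.
  by rewrite -subset0 => x /=; rewrite in_itv /= => /andP[x0 /(lt_trans x0)]; rewrite ltNge b0.
have [ubF|ubF] := pselect (has_ubound F); last first.
  exists (fun n => n%:R); split.
  - by move=> m n mn; rewrite ler_nat.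
  - move=> n; apply: contrapT => h; apply: ubF; exists n%:R => t Ft.
    by rewrite leNgt; apply/negP => nt; apply: h; exists t => //; exact: ltW.
  - exists set0; split => // t /F0 /=; rewrite in_itv /= andbT => t0'; left.
    exists (Num.bound t) => //=; rewrite in_itv /= t0' /=.
    exact/archi_boundP/ltW.
have hsF : has_sup F by split => //; exists t0.
exists (fun n => sup F - n.+1%:R^-1); split.
- by move=> m n mn; rewrite lerD2l lerN2 lef_pV2 ?posrE // ler_nat ltnS.
- move=> n; have lt : sup F - n.+1%:R^-1 < sup F.
    by rewrite ltrBlDr ltrDl invr_gt0.
  by have [|t Ft /ltW] := sup_gt _ lt; [exists t0|exists t].
exists [set sup F]; split => //.
- rewrite -set_itv1; exact: mI.
- by rewrite lebE lebesgue_measure_set1.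
move=> t Ft; have [tF|tF] := eqVneq t (sup F); [by right|left].
have {}tF : t < sup F by rewrite lt_neqAle tF; exact: ub_le_sup.
have d0 : 0 < sup F - t by rewrite subr_gt0.
exists (Num.bound (sup F - t)^-1) => //=.
have := F0 t Ft; rewrite /= !in_itv /= andbT => -> /=.
rewrite ltrBrDr -ltrBrDl invf_plt ?posrE //.
rewrite (lt_trans (archi_boundP _)) ?invr_ge0 ?(ltW d0) //.
by rewrite ltr_nat.
Qed.

(** Cutting the tail into the pieces on which [W / W 1] lies between two
    consecutive powers of 2 bounds the integral by a geometric series of ratio
    [2 `^ (1 - p)]. *)
Lemma integral_primitive_powR_lty (p : R) : 1 < p ->
  (\int[leb]_(t in (`[1%R, +oo[%classic : set L)) (w t * W t `^ (- p))%:E < +oo)%E.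
Proof.
move=> p1; have p0 : 0 < p by rewrite (lt_trans ltr01).
pose c := W 1; pose a : R := 2 `^ (- p); pose r := 2 * a.
have a0 : 0 < a by rewrite powR_gt0.
have r0 : 0 < r by rewrite mulr_gt0.
have r1 : r < 1.
  rewrite /r /a -{1}(@powRr1 _ 2) // -powRD ?pnatr_eq0 ?implybT //.
  rewrite /powR pnatr_eq0 /= expR_lt1 pmulr_llt0 ?ln_gt0 ?ltr1n //.
  by rewrite subr_lt0.
pose K := 2 * c * c `^ (- p).
have K0 : 0 < K by rewrite mulr_gt0 ?powR_gt0 // mulr_gt0.
have I0 : `[1, +oo[%classic `<=` (`]0, +oo[%classic : set R).
  by move=> t /=; rewrite !in_itv /= !andbT; exact: lt_le_trans.
pose f (t : L) : \bar R := (w t * W t `^ (- p))%:E.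
have mf (D : set L) : measurable D -> D `<=` `]0, +oo[%classic -> measurable_fun D f.
  move=> mD D0; apply/measurable_EFinP; apply: measurable_funM.
    exact: measurable_funS mw.
  apply: (measurableT_comp (measurable_powR (- p))).
  exact: measurable_primitive.
have f0 t : 0 < t -> (0 <= f t)%E.
  by move=> t0; rewrite lee_fin mulr_ge0 ?powR_ge0 // w0.
pose D (k : nat) : set L := `[1, +oo[%classic `&` sublevel (2 ^+ k * c).
have mF (b : R) : measurable (sublevel b : set L).
  rewrite (_ : sublevel b = `]0, +oo[%classic `&` W @^-1` `]-oo, b[%classic).
    exact: (measurable_primitive (mI _) (@subset_refl _ _) (mI _)
      (measurable_itv _)).
  by apply/seteqP; split=> t /=; rewrite !in_itv /= ?andbT.
have mD k : measurable (D k) by apply: measurableI.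
have D0 k : D k `<=` `]0, +oo[%classic by move=> t [/I0].
have ndD : nondecreasing_seq D.
  apply/nondecreasing_seqP => k; apply/subsetPset => t [t1 [t0 Wt]].
  split => //; split => //; apply: lt_le_trans Wt _.
  by rewrite ler_pM2r // exprS ler_peMl ?exprn_ge0 // ler1n.
have step k : (\int[leb]_(t in D k.+1 `\` D k) f t <= (K * r ^+ k)%:E)%E.
  pose b := 2 ^+ k * c.
  have b0 : 0 < b by rewrite mulr_gt0 // exprn_gt0.
  have mDD : measurable (D k.+1 `\` D k) by exact: measurableD.
  have DD0 : D k.+1 `\` D k `<=` `]0, +oo[%classic by move=> t [/D0].
  apply: (@le_trans _ _ (\int[leb]_(t in D k.+1 `\` D k) ((b `^ (- p))%:E * (w t)%:E))%E).
    apply: (ge0_le_integral leb mDD).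
    - by move=> t /DD0 /=; rewrite in_itv /= andbT => /f0.
    - exact: (mf _ mDD DD0).
    - by apply: measurable_funeM; exact: (mwS mDD DD0).
    move=> t [[t1 [t0 Wt]] nD]; rewrite /f -EFinM lee_fin mulrC ler_wpM2r ?w0 //.
    have bW : b <= W t by rewrite leNgt; apply/negP => Wb; apply: nD.
    rewrite !powRN lef_pV2 ?posrE ?powR_gt0 //; last exact: lt_le_trans bW.
    by rewrite ge0_ler_powR ?nnegrE // ltW // (lt_le_trans b0).
  rewrite (ge0_integralZl leb mDD (mwS mDD DD0)); last 2 first.
  - by move=> t /DD0 /=; rewrite in_itv /= andbT lee_fin => /w0.
  - by rewrite lee_fin powR_ge0.
  apply: (@le_trans _ _ ((b `^ (- p))%:E * (2 * b)%:E)%E).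
    apply: lee_wpmul2l; first by rewrite lee_fin powR_ge0.
    apply: le_trans (integral_sublevel_le (c := 2 * b) _); last by rewrite mulr_ge0 // ltW.
    apply: (ge0_subset_integral leb mDD (mF _)).
    - by apply: (mwS (mF _)) => t [t0 _]; rewrite /= in_itv /= t0.
    - by move=> t [t0 _]; rewrite lee_fin w0.
    - by move=> t [[_ [t0 Wt]] _]; split => //; rewrite /b mulrA -exprS.
  have ak : (2 ^+ k) `^ (- p) = a ^+ k :> R.
    by rewrite -[in LHS]powR_mulrn // -powRrM mulrC powRrM powR_mulrn // ltW.
  have c0 : 0 <= c by exact: ltW.
  rewrite -EFinM lee_fin /b powRM ?exprn_ge0 // ak /K /r exprMn.
  by rewrite le_eqVlt; apply/orP; left; apply/eqP; ring.
rewrite (_ : `[1, +oo[%classic = \bigcup_k D k); last first.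
  apply/seteqP; split=> [t t1|t [k _ []] //].
  have t0 : 0 < t by have := I0 t t1; rewrite /= in_itv /= andbT.
  exists (Num.bound (W t / c)) => //; split => //; split => //.
  rewrite -ltr_pdivrMr //.
  apply: (@lt_le_trans _ _ (Num.bound (W t / c))%:R).
    by apply: archi_boundP; rewrite divr_ge0 ?(ltW W1) // primitive_ge0.
  by rewrite -natrX ler_nat ltnW // ltn_expl.
apply: (@le_lt_trans _ _ (K / (1 - r))%:E); last exact: ltry.
apply: (ge0_integral_bigcup_le ndD mD).
- by move=> k; exact: (mf _ (mD k) (D0 k)).
- by move=> k t /D0 /=; rewrite in_itv /= andbT => /f0.
suff le k : (\int[leb]_(t in D k) f t <= (K / (1 - r) * (1 - r ^+ k))%:E)%E.
  move=> k; apply: le_trans (le k) _; rewrite lee_fin ler_piMr //.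
    by apply: divr_ge0; rewrite ?subr_ge0 ltW.
  by rewrite lerBlDr lerDl exprn_ge0 // ltW.
elim: k => [|k IH].
  rewrite (_ : D 0 = set0) ?integral_set0 ?expr0 ?subrr ?mulr0 //.
  rewrite -subset0 => t [t1 [_]]; rewrite expr0 mul1r ltNge primitive_homo //.
  by move: t1; rewrite /= in_itv /= andbT.
have DD : D k.+1 = D k `|` (D k.+1 `\` D k).
  by rewrite setDUK //; apply/subsetPset; exact: ndD.
have mDD : measurable (D k.+1 `\` D k) by exact: measurableD.
rewrite DD (ge0_integral_setU leb (mD k) mDD); last 3 first.
- by rewrite -DD; exact: (mf _ (mD _) (D0 _)).
- by move=> t; rewrite -DD => /D0 /=; rewrite in_itv /= andbT => /f0.
- by apply/disj_setPS => t [Dt [_ /(_ Dt)]].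
apply: le_trans (leeD IH (step k)) _.
rewrite -EFinD lee_fin le_eqVlt; apply/orP; left; apply/eqP.
rewrite exprS; field.
by rewrite subr_eq0 gt_eqF.
Qed.

End primitive.

Section tail_power.
Context {R : realType}.
Notation L := (lebesgueType R).

(** The constant density [1], whose primitive is the identity. *)
Lemma integral_tail_powR_lty (p : R) : 1 < p ->
  (\int[leb]_(t in (`[1%R, +oo[%classic : set L)) (t `^ (- p))%:E < +oo)%E.
Proof.
move=> p1; have := @integral_primitive_powR_lty R (fun=> 1) id _ _ _ _ p p1.
under eq_integral do rewrite mul1r.
apply => //.
  move=> x x0; rewrite integral_cst; last exact: measurable_lebesgue_itv.
  by rewrite mul1e [LHS](lebesgue_itv_oo (ltW x0)) subr0.
Qed.

End tail_power.


(** * Slowly varying functions and conjugate exponents *)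

Section slowly_varying_facts.
Context {R : realType}.

(** [t * b t] is equivalent to a nondecreasing function, hence at most a
    multiple of the value of that function at [1]. *)
Lemma slowly_varying_bounded (b : R -> R) : slowly_varying b ->
  exists2 C : R, 0 < C & forall t, 2^-1 <= t <= 1 -> b t <= C.
Proof.
move=> [_ b0 /(_ 1 ltr01)[[g gh [c1 [c2 [c10 c20 bg]]]] _]].
have in0 t : 0 < t -> t \in (`]0, +oo[ : interval R) by move=> t0; rewrite in_itv /= t0.
exists (2 * (c1 * `|g 1|) + 1).
  by rewrite ltr_wpDl // mulr_ge0 // mulr_ge0 // ltW.
move=> t /andP[t2 t1]; have t0 : 0 < t by rewrite (lt_le_trans _ t2) // invr_gt0.
have [le1 _] : t `^ 1 * b t <= c1 * g t /\ g t <= c2 * (t `^ 1 * b t).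
  by apply: bg; rewrite /= in_itv /= t0.
have gt : g t <= g 1 by apply: gh; rewrite ?in0.
rewrite powRr1 in le1; last exact: ltW.
have {}le1 : t * b t <= c1 * `|g 1|.
  by rewrite (le_trans le1) // ler_pM2l // (le_trans gt) // ler_norm.
apply: (@le_trans _ _ (2 * (t * b t))).
  rewrite mulrA ler_peMl ?(ltW (b0 _ t0)) //.
  by rewrite -(@ler_pM2l _ 2^-1) ?invr_gt0 // mulrA mulVf // mul1r mulr1.
by rewrite ler_wpDr // ler_pM2l.
Qed.

(** [t `^ 2^-1 * b t] is equivalent to a nondecreasing function, hence at least
    a multiple of [b 1]. *)
Lemma slowly_varying_inv_le (b : R -> R) : slowly_varying b ->
  exists2 C : R, 0 < C & forall t, 1 <= t -> (b t)^-1 <= C * t `^ 2^-1.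
Proof.
have h0 : 0 < (2^-1 : R) by rewrite invr_gt0.
move=> [_ b0 /(_ _ h0)[[g gh [c1 [c2 [c10 c20 bg]]]] _]].
have in0 t : 0 < t -> t \in (`]0, +oo[ : interval R) by move=> t0; rewrite in_itv /= t0.
exists (c1 * c2 / b 1).
  by rewrite divr_gt0 ?mulr_gt0 // b0.
move=> t t1; have t0 : 0 < t := lt_le_trans ltr01 t1.
have [_ le2] : t `^ 2^-1 * b t <= c1 * g t /\ g t <= c2 * (t `^ 2^-1 * b t).
  by apply: bg; rewrite /= in_itv /= t0.
have [le1 _] : 1 `^ 2^-1 * b 1 <= c1 * g 1 /\ g 1 <= c2 * (1 `^ 2^-1 * b 1).
  by apply: bg; rewrite /= in_itv /= ltr01.
have gt : g 1 <= g t by apply: gh; rewrite ?in0.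
rewrite powR1 mul1r in le1.
have bt := b0 t t0; have b1 := b0 1 ltr01.
have le : b 1 <= c1 * c2 * t `^ 2^-1 * b t.
  rewrite (le_trans le1) // -!mulrA ler_pM2l //.
  exact: le_trans gt le2.
rewrite -(ler_pM2r bt) mulVf ?gt_eqF //.
have -> : c1 * c2 / b 1 * t `^ 2^-1 * b t = (c1 * c2 * t `^ 2^-1 * b t) / b 1 by ring.
by rewrite ler_pdivlMr // mul1r.
Qed.

End slowly_varying_facts.

Section conjugate_exponents.
Context {R : realType}.

Lemma hoelder_conjugate_real (q : \bar R) (q' : R) : (1 < q)%E ->
  q' = fine (hoelder_conjugate q) ->
  [/\ 1 <= q', 0 <= fine (q^-1)%E & fine (q^-1)%E + q'^-1 = 1].
Proof.
case: q => [r|_|//]; last first.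
  by rewrite hoelder_conjugatey /= => ->; rewrite invr1 add0r.
rewrite lte_fin => r1; have r0 : 0 < r by rewrite (lt_trans ltr01).
have r10 : 0 < r - 1 by rewrite subr_gt0.
rewrite /hoelder_conjugate /= gt_eqF // -EFinB inver gt_eqF //= => ->.
rewrite inver gt_eqF //=; split.
- by rewrite ler_pdivlMr // mul1r gerBl.
- by rewrite invr_ge0 ltW.
- by field; rewrite !gt_eqF.
Qed.

End conjugate_exponents.

(** * The J-functional *)

Section Jfun_theory.
Context {R : realType} {Z : lmodType R} (Y0 Y1 : normed_in Z).
Hypotheses (s0 : seminormed Y0) (s1 : seminormed Y1).
Local Notation Cap := (capS Y0 Y1).
Local Notation J := (Jfun Y0 Y1).
Notation L := (lebesgueType R).

Lemma Jfun_ge0 x t : 0 <= J x t.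
Proof. by rewrite le_max nrm_ge0. Qed.

Lemma Jfun0 t : J 0 t = 0.
Proof. by rewrite /Jfun !nrm0 // mulr0 maxxx. Qed.

Lemma JfunD x y t : 0 <= t -> space Cap x -> space Cap y ->
  J (x + y) t <= J x t + J y t.
Proof.
move=> t0 [x0 x1] [y0 y1]; rewrite ge_max; apply/andP; split.
  by apply: le_trans (ler_nrmD s0 x0 y0) _; apply: lerD; rewrite le_max lexx.
apply: le_trans (ler_wpM2l t0 (ler_nrmD s1 x1 y1)) _.
by rewrite mulrDr; apply: lerD; rewrite le_max lexx orbT.
Qed.

Lemma JfunZ_le x t c : 0 <= t <= 1 -> space Cap x ->
  J (c *: x) t <= `|c| * nrm Cap x.
Proof.
move=> /andP[t0 t1] [x0 x1]; rewrite ge_max; apply/andP; split.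
  by apply: le_trans (ler_nrmZ s0 c x0) _; rewrite ler_wpM2l //= le_max lexx.
apply: (@le_trans _ _ (nrm Y1 (c *: x))); first by rewrite ler_piMl ?nrm_ge0.
by apply: le_trans (ler_nrmZ s1 c x1) _; rewrite ler_wpM2l //= le_max lexx orbT.
Qed.

Lemma measurable_Jfun (D : set L) (u : L -> Z) : measurable D ->
  strongly_measurable leb D Cap u -> measurable_fun D (fun t => J (u t) t).
Proof.
move=> mD mu.
have mu0 : strongly_measurable leb D Y0 u.
  apply: (strongly_measurable_le mD _ s0 _ _ mu).
  - exact: capS_seminormed.
  - by move=> x [].
  - by move=> x _; rewrite /= le_max lexx.
have mu1 : strongly_measurable leb D Y1 u.
  apply: (strongly_measurable_le mD _ s1 _ _ mu).
  - exact: capS_seminormed.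
  - by move=> x [].
  - by move=> x _; rewrite /= le_max lexx orbT.
have cmu := @completed_lebesgue_measure_is_complete R.
apply: measurable_maxr; first exact: (measurable_nrm mD cmu s0 mu0).
apply: measurable_funM; last exact: (measurable_nrm mD cmu s1 mu1).
by apply: (borel_lebesgue_measurable_fun (E := setT) mD).
Qed.

End Jfun_theory.

(** * J-spaces over the half-line and the unit interval *)

Section weights.
Context {R : realType}.
Notation L := (lebesgueType R).

(** The [q]-norm of [weight q v t * h t] is that of [v t * h t] with respect to
    the measure [dt / t]. *)
Definition weight (q : \bar R) (v : R -> R) (t : R) : R :=
  t `^ (- fine (q^-1)%E) * v t.

Lemma weighted_normE (q : \bar R) (v : R -> R) (I : set R) (h : R -> R) :
  weighted_norm q v I h =
  'N[leb]_q[EFin \o ((fun t : L => weight q v t * h t)%R \_ I)]%E.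
Proof. by rewrite /weighted_norm -restrict_EFin. Qed.

Lemma weight_ge0 q v t : 0 <= v t -> 0 <= weight q v t.
Proof. by move=> v0; rewrite mulr_ge0 ?powR_ge0. Qed.

Lemma measurable_weight q v (D : set L) :
  measurable_fun (`]0, +oo[%classic : set L) v ->
  measurable D -> D `<=` `]0, +oo[%classic -> measurable_fun D (weight q v).
Proof.
move=> mv mD D0; apply: measurable_funM; first exact: (measurable_lebesgue_powR _ mD).
exact: (measurable_funS (measurable_lebesgue_itv _) D0 mv).
Qed.

End weights.

Section Jspace_localization.
Context {R : realType} {Z : lmodType R} (Y0 Y1 : normed_in Z).
Hypotheses (s0 : seminormed Y0) (s1 : seminormed Y1).
Local Notation Cap := (capS Y0 Y1).
Local Notation Sum := (sumS Y0 Y1).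
Local Notation J := (Jfun Y0 Y1).
Notation L := (lebesgueType R).
Hypothesis cC : complete_in Cap.
Variables (q : \bar R) (q' : R) (v psi : R -> R).
Hypotheses (hq : (1 < q)%E) (hq' : q' = fine (hoelder_conjugate q))
  (hv : slowly_varying v)
  (mpsi : measurable_fun (`[1, +oo[%classic : set L) psi)
  (psiJ : forall t x, 1 <= t -> space Cap x -> nrm Cap x <= psi t * J x t)
  (psi0 : forall t, 1 <= t -> 0 <= psi t)
  (psi_int : (\int[leb]_(t in (`[1%R, +oo[%classic : set L))
     (t^-1 * (psi t / v t) `^ q')%:E < +oo)%E).

Let sC : seminormed Cap. Proof. exact: capS_seminormed. Qed.
Let sS : seminormed Sum. Proof. exact: sumS_seminormed. Qed.

Let Dpos : set L := `]0, +oo[%classic.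
Let Dtail : set L := `[1, +oo[%classic.
Let Dhead : set L := `]0, 1[%classic.
Let Dhalf : set L := `]2^-1, 1[%classic.

Let mpos : measurable Dpos. Proof. exact: measurable_lebesgue_itv. Qed.
Let mtail : measurable Dtail. Proof. exact: measurable_lebesgue_itv. Qed.
Let mhead : measurable Dhead. Proof. exact: measurable_lebesgue_itv. Qed.
Let mhalf : measurable Dhalf. Proof. exact: measurable_lebesgue_itv. Qed.

Let tail_pos : Dtail `<=` Dpos.
Proof. by move=> t; rewrite /Dtail /Dpos /= !in_itv /= !andbT; exact: lt_le_trans. Qed.
Let head_pos : Dhead `<=` Dpos.
Proof. by move=> t; rewrite /Dhead /Dpos /= !in_itv /= => /andP[->]. Qed.
Let half_head : Dhalf `<=` Dhead.
Proof.
move=> t; rewrite /Dhead /Dhalf /= !in_itv /= => /andP[t2 ->].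
by rewrite (lt_trans _ t2) // invr_gt0.
Qed.

Let posD : Dpos `\` Dtail = Dhead.
Proof.
apply/seteqP; split=> t; rewrite /Dpos /Dtail /Dhead /= !in_itv /= !andbT.
  by move=> [-> /negP]; rewrite -ltNge.
by move=> /andP[-> t1]; split => //; apply/negP; rewrite -ltNge.
Qed.

Let cmu := @completed_lebesgue_measure_is_complete R.

Let v0 t : 0 < t -> 0 < v t. Proof. by case: hv => _ h _; exact: h. Qed.
Let mv : measurable_fun Dpos v. Proof. by case: hv. Qed.

Let exps : [/\ 1 <= q', 0 <= fine (q^-1)%E & fine (q^-1)%E + q'^-1 = 1].
Proof. exact: hoelder_conjugate_real. Qed.
Let q'0 : 0 < q'. Proof. by case: exps => h _ _; exact: lt_le_trans h. Qed.

(** The Hoelder partner of [weight q v]: on the tail, the product of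
    [weight q v t] and [G t] is [t^-1 * psi t]. *)
Let G (t : L) : R := t `^ (- q'^-1) * (psi t / v t).

Let G0 t : Dtail t -> 0 <= G t.
Proof.
move=> t1; have tpos := tail_pos t1.
rewrite mulr_ge0 ?powR_ge0 // divr_ge0 //.
  by apply: psi0; move: t1; rewrite /Dtail /= in_itv /= andbT.
by apply/ltW/v0; move: tpos; rewrite /Dpos /= in_itv /= andbT.
Qed.

Let mG : measurable_fun setT (G \_ Dtail).
Proof.
apply/(measurable_restrictT G mtail).
apply: measurable_funM; first exact: measurable_lebesgue_powR.
apply: measurable_funM; first exact: mpsi.
apply: (eq_measurable_fun (fun t : L => v t `^ (-1))).
  move=> t /set_mem /tail_pos; rewrite /Dpos /= in_itv /= andbT => t0.
  by rewrite powR_inv1 // ltW // v0.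
apply: (measurableT_comp (measurable_powR (-1))).
exact: (measurable_funS mpos tail_pos mv).
Qed.

Let NG := fine 'N[leb]_(q'%:E)[EFin \o (G \_ Dtail)]%E.

Let NGE : 'N[leb]_(q'%:E)[EFin \o (G \_ Dtail)]%E = NG%:E.
Proof.
rewrite /NG fineK // ge0_fin_numE ?Lnorm_ge0 // LnormEr poweR_lty //.
rewrite (_ : (\int[leb]_t _)%E = (\int[leb]_(t in Dtail)
   (t^-1 * (psi t / v t) `^ q')%:E)%E) //.
rewrite [RHS]integral_mkcond; apply: eq_integral => t _.
rewrite !patchE; case: ifPn => [/set_mem t1|_]; last first.
  by rewrite normr0 powR0 // gt_eqF.
have t0 : 0 < t by move: (tail_pos t1); rewrite /Dpos /= in_itv /= andbT.
rewrite ger0_norm; last exact: G0.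
rewrite /G powRM ?powR_ge0 //; last first.
  rewrite divr_ge0 ?(ltW (v0 t0)) // psi0 //.
  by move: t1; rewrite /Dtail /= in_itv /= andbT.
by rewrite -powRrM mulNr mulVf ?gt_eqF // powR_inv1 // ltW.
Qed.

Let Fu (u : L -> Z) (t : L) : R := weight q v t * J (u t) t.

Let mFu (D : set L) u : measurable D -> D `<=` Dpos ->
  strongly_measurable leb D Cap u -> measurable_fun setT (Fu u \_ D).
Proof.
move=> mD D0 mu; apply/(measurable_restrictT (Fu u) mD).
have mW := measurable_weight q mv mD D0.
exact: (measurable_funM mW (measurable_Jfun s0 s1 mD mu)).
Qed.

Let Fu0 (u : L -> Z) t : Dpos t -> 0 <= Fu u t.
Proof.
rewrite /Dpos /= in_itv /= andbT => t0.
by rewrite mulr_ge0 ?Jfun_ge0 // weight_ge0 // ltW // v0.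
Qed.

Let wu (u : L -> Z) (s : L) : Z := (s : R)^-1 *: u s.

(** On the tail, [nrm Cap (t^-1 *: u t) <= t^-1 * psi t * J (u t) t], which
    is the product of the weighted J-functional and [G]. *)
Lemma ex_tail_integral (u : L -> Z) : strongly_measurable leb Dpos Cap u ->
  (weighted_norm q v Dpos (fun t => J (u t) t) < +oo)%E ->
  exists2 g, is_bochner_integral leb Dtail Cap (wu u) g &
    ((nrm Cap g)%:E <= NG%:E * weighted_norm q v Dpos (fun t => J (u t) t))%E.
Proof.
move=> mu Nfin.
have mut : strongly_measurable leb Dtail Cap u.
  exact: (strongly_measurableS mpos mtail tail_pos mu).
have mwt : strongly_measurable leb Dtail Cap (wu u).
  apply: (strongly_measurableZ mtail sC _ mut).
  exact: measurable_lebesgue_inv.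
have Yu t : Dpos t -> space Cap (u t) by case: mu => h _; exact: h.
have mprod : measurable_fun setT (fun t : L => `|(Fu u \_ Dpos) t * (G \_ Dtail) t|).
  apply: (measurableT_comp (@normr_measurable R setT)).
  exact: (measurable_funM (mFu mpos (@subset_refl _ _) mu) mG).
have bound : (\int[leb]_(t in Dtail) (nrm Cap (wu u t))%:E <=
    NG%:E * weighted_norm q v Dpos (fun t => J (u t) t))%E.
  rewrite integral_mkcond weighted_normE muleC -NGE.
  rewrite weighted_normE in Nfin.
  apply: le_trans; last first.
    apply: (hoelder_ereal (mu := leb) _ (mFu mpos (@subset_refl _ _) mu) mG hq hq' Nfin).
    exact: lebesgue_setT_gt0.
  apply: (ge0_le_integral leb measurableT).
  - by move=> t _; rewrite patchE; case: ifP => // _; rewrite lee_fin nrm_ge0.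
  - apply/(measurable_restrictT _ mtail)/measurable_EFinP.
    exact: (measurable_nrm mtail cmu sC mwt).
  - exact/measurable_EFinP.
  move=> t _; rewrite !patchE; case: ifPn => [t1|_]; last first.
    by rewrite lee_fin normr_ge0.
  have {}t1 := set_mem t1; have tp := tail_pos t1.
  rewrite mem_set // lee_fin ger0_norm; last by rewrite mulr_ge0 ?Fu0 ?G0.
  have t0 : 0 < t by move: tp; rewrite /Dpos /= in_itv /= andbT.
  have t1' : 1 <= t by move: t1; rewrite /Dtail /= in_itv /= andbT.
  apply: le_trans (ler_nrmZ sC _ (Yu _ tp)) _.
  rewrite ger0_norm ?invr_ge0 ?(ltW t0) //.
  apply: le_trans (ler_wpM2l _ (psiJ t1' (Yu _ tp))) _.
    by rewrite invr_ge0 ltW.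
  rewrite le_eqVlt; apply/orP; left; apply/eqP.
  rewrite /Fu /weight /G.
  have -> : (t : R)^-1 = t `^ (- fine (q^-1)%E) * t `^ (- q'^-1).
    rewrite -powRD; last by rewrite (gt_eqF t0) implybT.
    by rewrite -opprD; case: exps => _ _ ->; rewrite powR_inv1 // ltW.
  by field; rewrite gt_eqF // v0.
have iw : (\int[leb]_(t in Dtail) (nrm Cap (wu u t))%:E < +oo)%E.
  apply: le_lt_trans bound _; apply: lte_mul_pinfty => //.
  by rewrite lee_fin fine_ge0 // Lnorm_ge0.
have [] := @ex_bochner_integral _ _ _ _ leb cmu Dtail Cap (wu u)
  (fun n => (`]0, n%:R[%classic : set L)) mtail sC cC _ _ _ mwt iw.
- by move=> n; exact: measurable_lebesgue_itv.
- by move=> n; rewrite [X in (X < _)%E](lebesgue_itv_oo (ler0n R n)) ltry.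
- move=> t /tail_pos; rewrite /Dpos /= in_itv /= andbT => t0.
  exists (Num.bound t) => // n /= tn; rewrite in_itv /= t0 /=.
  apply: lt_le_trans (archi_boundP (ltW t0)) _.
  by rewrite ler_nat.
move=> g bg ng; exists g => //; exact: le_trans ng bound.
Qed.

Let H (t : L) : R := 2 * weight q v t.

Let mH : measurable_fun setT (H \_ Dhalf).
Proof.
apply/(measurable_restrictT H mhalf); apply: measurable_funM.
  exact: measurable_cst.
exact: (measurable_weight q mv mhalf (subset_trans half_head head_pos)).
Qed.

Let NH := fine 'N[leb]_q[EFin \o (H \_ Dhalf)]%E.

Let NHE : 'N[leb]_q[EFin \o (H \_ Dhalf)]%E = NH%:E.
Proof.
rewrite /NH fineK // ge0_fin_numE ?Lnorm_ge0 //.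
have [C C0 vC] := slowly_varying_bounded hv.
have half_fin : (leb Dhalf < +oo)%E.
  by rewrite [X in (X < _)%E]lebesgue_itv_oo ?ltry // invf_le1 ?ler1n.
apply: (Lnorm_bounded_lty (M := 2 * (2^-1 `^ (- fine (q^-1)%E) * C)) mhalf half_fin mH).
  by rewrite (lt_trans _ hq).
move=> t; rewrite patchE indicE; case: ifPn => [|_]; last by rewrite normr0 mulr0.
rewrite mulr1 => /set_mem; rewrite /Dhalf /= in_itv /= => /andP[t2 t1].
have t0 : 0 < t by rewrite (lt_trans _ t2) // invr_gt0.
have vt := v0 t0.
rewrite ger0_norm; last by rewrite mulr_ge0 // weight_ge0 // ltW.
rewrite ler_pM2l // ler_pM ?powR_ge0 ?(ltW vt) //.
  have [_ e0 _] := exps.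
  rewrite !powRN lef_pV2 ?posrE ?powR_gt0 ?invr_gt0 //.
  by apply: ge0_ler_powR => //; rewrite ?nnegrE ?invr_ge0 // ltW.
by apply: vC; rewrite !ltW.
Qed.

Let q0 : (0 < q)%E. Proof. exact: lt_trans hq. Qed.

(** The tail integral [g] is moved to (1/2, 1) as the integral of the
    constant [2 *: g]. There [J g t <= nrm Cap g], since [t <= 1], and the weight
    is bounded. *)
Lemma ex_Jrepresents_head (u : L -> Z) f : Jrepresents Y0 Y1 Dpos u f ->
  (weighted_norm q v Dpos (fun t => J (u t) t) < +oo)%E ->
  exists2 u', Jrepresents Y0 Y1 Dhead u' f &
   (weighted_norm q v Dhead (fun t => J (u' t) t) <=
    (1 + NG * NH)%:E * weighted_norm q v Dpos (fun t => J (u t) t))%E.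
Proof.
move=> [mu bf] Nfin; have [g bg ng] := ex_tail_integral mu Nfin.
have Yg : space Cap g by case: bg.
have Yu t : Dpos t -> space Cap (u t) by case: mu => h _; exact: h.
pose a (t : L) : R := 2 * (t : R) * \1_Dhalf t.
have ma : measurable_fun Dhead a.
  apply: measurable_funM; last exact: measurable_indic.
  apply: measurable_funM; first exact: measurable_cst.
  by apply: (borel_lebesgue_measurable_fun (E := setT) mhead).
pose u' (t : L) : Z := u t + a t *: g.
have muh : strongly_measurable leb Dhead Cap u.
  exact: (strongly_measurableS mpos mhead head_pos mu).
have mu' : strongly_measurable leb Dhead Cap u'.
  apply: (strongly_measurableD mhead sC muh).
  apply: (strongly_measurableZ mhead sC ma).
  exact: (strongly_measurable_cst leb mhead sC Yg).
have two0 : (2 : R) != 0 by rewrite pnatr_eq0.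
have Yg2 : space Cap (2 *: g) by exact: spaceZ.
have bf' : is_bochner_integral leb Dhead Sum (wu u') f.
  have half_fin : leb Dhalf = (2^-1)%:E.
    rewrite [LHS]lebesgue_itv_oo ?invf_le1 ?ler1n //; congr EFin.
    by field.
  have bh := is_bochner_integralB cmu mpos mtail tail_pos sS sC
    (capS_subset_sumS s1) (sumS_nrm_le_capS s0 s1) bf bg.
  rewrite posD in bh.
  have half_lty : (leb Dhalf < +oo)%E by rewrite half_fin ltry.
  have := is_bochner_integral_addcst mhead mhalf half_head half_lty sS
    (capS_subset_sumS s1 Yg2) bh.
  rewrite [X in X *: (_ *: _)](congr1 fine half_fin : _ = 2^-1).
  rewrite scalerA (mulVf two0) scale1r subrK.
  apply: (eq_is_bochner_integral mhead) => t.
  rewrite /Dhead /= in_itv /= => /andP[t0 _].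
  rewrite /wu /u' /a scalerDr scalerA indicE; congr (_ + _).
  case: (t \in Dhalf); last by rewrite !mulr0 scale0r.
  by rewrite mulr1 mulrCA mulVf ?gt_eqF // mulr1.
exists u'; first by split.
rewrite !weighted_normE.
have mFup := mFu mpos (@subset_refl _ _) mu.
have mgH : measurable_fun setT (fun t => nrm Cap g * (H \_ Dhalf) t).
  exact: (measurable_funM (measurable_cst _) mH).
apply: (@le_trans _ _ 'N[leb]_q[EFin \o
    ((Fu u \_ Dpos) \+ (fun t => nrm Cap g * (H \_ Dhalf) t))%R]%E).
  apply: (le_Lnorm leb (mFu mhead head_pos mu') (measurable_funD mFup mgH) q0).
  move=> t; rewrite patchE; case: ifPn => [/set_mem th|_]; last by rewrite normr0.
  have tp := head_pos th.
  have [t0 t1] : 0 < t /\ t <= 1.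
    by move: th; rewrite /Dhead /= in_itv /= => /andP[-> /ltW].
  have wt : 0 <= weight q v t by rewrite weight_ge0 // ltW // v0.
  rewrite ger0_norm; last by rewrite mulr_ge0 ?Jfun_ge0.
  apply: le_trans (ler_norm _); rewrite /= patchE mem_set //.
  have Yag : space Cap (a t *: g) by exact: spaceZ.
  apply: le_trans (ler_wpM2l wt (JfunD s0 s1 (ltW t0) (Yu _ tp) Yag)) _.
  rewrite mulrDr lerD2l.
  have t01 : 0 <= t <= 1 by rewrite (ltW t0).
  apply: le_trans (ler_wpM2l wt (JfunZ_le s0 s1 (a t) t01 Yg)) _.
  rewrite patchE /a indicE; case: (t \in Dhalf); last first.
    by rewrite !mulr0 normr0 mul0r mulr0.
  rewrite mulr1 ger0_norm; last by rewrite mulr_ge0 // ltW.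
  rewrite /H [leLHS]mulrA [leRHS]mulrC ler_wpM2r ?(nrm_ge0 sC) //.
  by rewrite [leLHS]mulrC ler_wpM2r // ler_piMr.
apply: le_trans (eminkowski leb mFup mgH (ltW hq)) _.
rewrite (Lnorm_scale leb mH q0 (nrm_ge0 sC g)) NHE.
have NGH0 : (0 <= (NG * NH)%:E)%E.
  by rewrite lee_fin mulr_ge0 // fine_ge0 // Lnorm_ge0.
rewrite EFinD (ge0_muleDl _ lee01 NGH0) mul1e.
apply: leeD; first exact: lexx.
rewrite weighted_normE in ng.
rewrite EFinM muleAC.
by apply: lee_wpmul2r ng; rewrite lee_fin fine_ge0 // Lnorm_ge0.
Qed.

Lemma Jnorm_head_le f :
  (Jnorm Y0 Y1 q v Dhead f <= (1 + NG * NH)%:E * Jnorm Y0 Y1 q v Dpos f)%E.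
Proof.
have C0 : 0 < 1 + NG * NH.
  by rewrite ltr_wpDr // mulr_ge0 // fine_ge0 // Lnorm_ge0.
rewrite -lee_pdivrMl //; apply: le_ereal_inf_tmp => _ [u ru <-].
rewrite lee_pdivrMl //.
have [Ny|Nfin] := leP +oo%E (weighted_norm q v Dpos (fun t => J (u t) t)).
  move: Ny; rewrite leye_eq => /eqP ->.
  by rewrite gt0_muley ?leey // lte_fin.
have [u' ru' le_u'] := ex_Jrepresents_head ru Nfin.
by apply: le_trans le_u'; apply: ereal_inf_lbound; exists u'.
Qed.

Lemma Jnorm_le_head f :
  (Jnorm Y0 Y1 q v Dpos f <= Jnorm Y0 Y1 q v Dhead f)%E.
Proof.
apply: le_ereal_inf_tmp => _ [u [mu bu] <-]; apply: ereal_inf_lbound.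
exists (fun t : L => if t \in Dhead then u t else 0).
  split; first exact: (strongly_measurable_cut mpos mhead sC head_pos mu).
  have := is_bochner_integral_cut mpos mhead head_pos sS bu.
  apply: (eq_is_bochner_integral mpos) => t _.
  by case: ifP; rewrite ?scaler0.
rewrite !weighted_normE; congr 'N[leb]_q[EFin \o _]%E.
apply/funext => t; rewrite !patchE.
case: ifPn => [_|tp]; last first.
  rewrite memNset //; move/negP: tp => tp /head_pos th; apply: tp.
  exact: mem_set.
by case: ifP => // _; rewrite Jfun0 // mulr0.
Qed.

Lemma same_Jspace :
  same_space (Jspace Y0 Y1 q v `]0, +oo[) (Jspace Y0 Y1 q v `]0, 1[).
Proof.
have Jn0 (I : set R) f : (0 <= Jnorm Y0 Y1 q v I f)%E.
  by apply: le_ereal_inf_tmp => _ [u _ <-]; exact: Lnorm_ge0.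
have C0 : 0 < 1 + NG * NH.
  by rewrite ltr_wpDr // mulr_ge0 // fine_ge0 // Lnorm_ge0.
apply: (same_space_norms ltr01 C0 (Jn0 _) (Jn0 _)).
- by move=> f _; rewrite mul1e; exact: Jnorm_le_head.
- by move=> f _; exact: Jnorm_head_le.
Qed.

End Jspace_localization.

(** * K-spaces over the half-line and the unit interval *)

Section Kspace_localization.
Context {R : realType} {Z : lmodType R} (Y0 Y1 : normed_in Z).
Hypotheses (s0 : seminormed Y0) (s1 : seminormed Y1)
  (Y10 : space Y1 `<=` space Y0)
  (nY10 : forall x, space Y1 x -> nrm Y0 x <= nrm Y1 x).
Local Notation K := (Kfun Y0 Y1).
Notation L := (lebesgueType R).
Variables (q : \bar R) (v : R -> R).
Hypotheses (hq : (1 < q)%E)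
  (mv : measurable_fun (`]0, +oo[%classic : set L) v)
  (v0 : forall t, 0 < t -> 0 < v t)
  (v_tail : ('N[leb]_q[EFin \o (weight q v \_ (`[1%R, +oo[%classic : set L))] < +oo)%E).

Let Dpos : set L := `]0, +oo[%classic.
Let Dtail : set L := `[1, +oo[%classic.
Let Dhead : set L := `]0, 1[%classic.

Let mpos : measurable Dpos. Proof. exact: measurable_lebesgue_itv. Qed.
Let mtail : measurable Dtail. Proof. exact: measurable_lebesgue_itv. Qed.
Let mhead : measurable Dhead. Proof. exact: measurable_lebesgue_itv. Qed.

Let tail_pos : Dtail `<=` Dpos.
Proof. by move=> t; rewrite /Dtail /Dpos /= !in_itv /= !andbT; exact: lt_le_trans. Qed.
Let head_pos : Dhead `<=` Dpos.
Proof. by move=> t; rewrite /Dhead /Dpos /= !in_itv /= => /andP[->]. Qed.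

Let q0 : (0 < q)%E. Proof. exact: lt_trans hq. Qed.

Let sum0 f : space (sumS Y0 Y1) f -> space Y0 f.
Proof. by move=> [f0 [f1 [? ? ->]]]; apply: spaceD => //; exact: Y10. Qed.

Lemma Kfun_le_nrm f t : 0 <= t -> space Y0 f -> K f t <= nrm Y0 f.
Proof.
move=> t0 Yf; apply: le_trans (@Kfun_le _ _ _ _ s0 s1 f f 0 t t0 Yf (space0 s1) _) _.
  by rewrite addr0.
by rewrite nrm0 // mulr0 addr0.
Qed.

(** For [f = f0 + f1] the norm of [f] in [Y0] is at most
    [nrm Y0 f0 + nrm Y1 f1], and [t <= 1]. *)
Lemma nrm_le_Kfun f t : 0 < t <= 1 -> space (sumS Y0 Y1) f ->
  t * nrm Y0 f <= K f t.
Proof.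
move=> /andP[t0 t1] Sf; apply: Kfun_ge => // f0 f1 Yf0 Yf1 ->.
have Yf1' := Y10 Yf1.
apply: le_trans (ler_wpM2l (ltW t0) (ler_nrmD s0 Yf0 Yf1')) _.
rewrite mulrDr; apply: lerD; first by rewrite ler_piMl ?nrm_ge0.
by rewrite ler_pM2l // nY10.
Qed.

Let mK f (D : set L) : measurable D -> D `<=` Dpos -> space (sumS Y0 Y1) f ->
  measurable_fun D (K f).
Proof.
move=> mD D0 Sf.
apply: (eq_measurable_fun (fun t : L => if (0 : R) < t then K f t else 0)).
  by move=> t /set_mem /D0; rewrite /Dpos /= in_itv /= andbT => ->.
apply: (borel_lebesgue_measurable_fun (E := setT) mD) => //.
apply: nondecreasing_measurable => // x y xy.
case: ifPn => x0; case: ifPn => y0 //.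
- exact: (Kfun_homo s0 s1 (ltW x0)).
- by rewrite (lt_le_trans x0 xy) in y0.
- by apply: (Kfun_ge0 s0 s1); exact: ltW.
Qed.

Let F f (t : L) : R := weight q v t * K f t.

Let mF f (D : set L) : measurable D -> D `<=` Dpos -> space (sumS Y0 Y1) f ->
  measurable_fun setT (F f \_ D).
Proof.
move=> mD D0 Sf; apply/(measurable_restrictT (F f) mD).
exact: (measurable_funM (measurable_weight q mv mD D0) (mK mD D0 Sf)).
Qed.

Let F0 f t : Dpos t -> 0 <= F f t.
Proof.
rewrite /Dpos /= in_itv /= andbT => t0.
by rewrite mulr_ge0 ?(Kfun_ge0 s0 s1) ?ltW // mulr_gt0 ?powR_gt0 // v0.
Qed.

Let G (t : L) : R := t * weight q v t.

Let mG : measurable_fun setT (G \_ Dhead).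
Proof.
apply/(measurable_restrictT G mhead).
have mid : measurable_fun Dhead (fun t : L => t : R).
  exact: (borel_lebesgue_measurable_fun (E := setT) mhead).
exact: (measurable_funM mid (measurable_weight q mv mhead head_pos)).
Qed.

Let mH : measurable_fun setT (weight q v \_ Dtail : L -> R).
Proof.
apply/(measurable_restrictT (weight q v : L -> R) mtail).
exact: (measurable_weight q mv mtail tail_pos).
Qed.

Let w0 t : 0 < t -> 0 < weight q v t.
Proof. by move=> t0; rewrite mulr_gt0 ?powR_gt0 // v0. Qed.

Let nrm_le_head f : space (sumS Y0 Y1) f ->
  ((nrm Y0 f)%:E * 'N[leb]_q[EFin \o (G \_ Dhead)] <=
   Knorm Y0 Y1 q v Dhead f)%E.
Proof.
move=> Sf; rewrite /Knorm weighted_normE.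
rewrite -(Lnorm_scale leb mG q0 (nrm_ge0 s0 f)).
have mGs := measurable_funM (measurable_cst (nrm Y0 f)) mG.
apply: (le_Lnorm leb mGs (mF mhead head_pos Sf) q0) => t.
rewrite /= !patchE; case: ifPn => [/set_mem th|_]; last by rewrite mulr0.
have [t0 t1] : 0 < t /\ t <= 1.
  by move: th; rewrite /Dhead /= in_itv /= => /andP[-> /ltW].
have wt := ltW (w0 t0).
rewrite ger0_norm; last by rewrite mulr_ge0 ?(nrm_ge0 s0) // mulr_ge0 // ltW.
apply: le_trans (ler_norm _).
rewrite /G mulrA mulrC ler_wpM2l // mulrC nrm_le_Kfun //.
by rewrite t0.
Qed.

Let Knorm_le f : space (sumS Y0 Y1) f ->
  (Knorm Y0 Y1 q v Dpos f <= Knorm Y0 Y1 q v Dhead f +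
   (nrm Y0 f)%:E * 'N[leb]_q[EFin \o (weight q v \_ Dtail)])%E.
Proof.
move=> Sf; rewrite /Knorm !weighted_normE.
rewrite -(Lnorm_scale leb mH q0 (nrm_ge0 s0 f)).
have mHs := measurable_funM (measurable_cst (nrm Y0 f)) mH.
have mFh := mF mhead head_pos Sf.
apply: le_trans (eminkowski leb mFh mHs (ltW hq)).
apply: (le_Lnorm leb (mF mpos (@subset_refl _ _) Sf) (measurable_funD mFh mHs) q0) => t.
rewrite patchE; case: ifPn => [/set_mem tp|_]; last by rewrite normr0.
have t0 : 0 < t by move: tp; rewrite /Dpos /= in_itv /= andbT.
rewrite ger0_norm; last exact: F0.
apply: le_trans (ler_norm _); rewrite /= !patchE.
have [t1|t1] := ltP t 1.
  rewrite mem_set ?memNset ?mulr0 ?addr0 //.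
    by rewrite /Dtail /= in_itv /= andbT; apply/negP; rewrite -ltNge.
  by rewrite /Dhead /= in_itv /= t0.
rewrite memNset ?mem_set ?add0r //; last 2 first.
- by rewrite /Dtail /= in_itv /= andbT.
- by rewrite /Dhead /= in_itv /= => /andP[_]; rewrite ltNge t1.
rewrite /F mulrC ler_wpM2r // ?(ltW (w0 t0)) //.
by apply: Kfun_le_nrm; [exact: ltW|exact: sum0].
Qed.

Lemma same_Kspace :
  same_space (Kspace Y0 Y1 q v `]0, +oo[) (Kspace Y0 Y1 q v `]0, 1[).
Proof.
have Kn0 (I : set R) f : (0 <= Knorm Y0 Y1 q v I f)%E by exact: Lnorm_ge0.
have head_gt0 : (0 < leb Dhead)%E.
  by rewrite [X in (_ < X)%E](lebesgue_itv_oo ler01) subr0 lte_fin.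
have c0 : (0 < 'N[leb]_q[EFin \o (G \_ Dhead)])%E.
  apply: (Lnorm_gt0 mhead head_gt0 mG q0) => t th.
  rewrite patchE mem_set // gt_eqF //.
  have t0 : 0 < t by move: (head_pos th); rewrite /Dpos /= in_itv /= andbT.
  by rewrite mulr_gt0 // w0.
(* a real lower bound of a norm that may be infinite *)
have [c c_gt0 cN] : exists2 c : R, 0 < c &
    (c%:E <= 'N[leb]_q[EFin \o (G \_ Dhead)])%E.
  case: ('N[leb]_q[_])%E c0 => [r|_|//]; first by rewrite lte_fin; exists r.
  by exists 1 => //; exact: leey.
pose M := fine 'N[leb]_q[EFin \o (weight q v \_ Dtail)]%E.
have ME : 'N[leb]_q[EFin \o (weight q v \_ Dtail)]%E = M%:E.
  by rewrite /M fineK // ge0_fin_numE // Lnorm_ge0.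
have M0 : 0 <= M by rewrite fine_ge0 // Lnorm_ge0.
have C0 : 0 < 1 + c^-1 * M.
  by rewrite ltr_wpDr // mulr_ge0 // invr_ge0 ltW.
apply: (@same_space_norms _ _ (space (sumS Y0 Y1)) (Knorm Y0 Y1 q v Dpos)
  (Knorm Y0 Y1 q v Dhead) (1 + c^-1 * M) 1 C0 ltr01 (Kn0 _) (Kn0 _)) => f Sf.
  apply: le_trans (Knorm_le Sf) _; rewrite ME.
  have cM0 : (0 <= (c^-1 * M)%:E)%E.
    by rewrite lee_fin mulr_ge0 // invr_ge0 ltW.
  rewrite EFinD (ge0_muleDl _ lee01 cM0) mul1e; apply: leeD; first exact: lexx.
  rewrite [(c^-1 * M)%R]mulrC EFinM muleC -muleA.
  apply: lee_wpmul2l; first by rewrite lee_fin.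
  rewrite lee_pdivlMl //; apply: le_trans (nrm_le_head Sf).
  by rewrite muleC; apply: lee_wpmul2l => //; rewrite lee_fin nrm_ge0.
rewrite mul1e /Knorm !weighted_normE.
apply: (le_Lnorm leb (mF mhead head_pos Sf) (mF mpos (@subset_refl _ _) Sf) q0) => t.
rewrite !patchE; case: ifPn => [/set_mem th|_]; last by rewrite normr0 normr_ge0.
by rewrite mem_set //; exact: head_pos.
Qed.

End Kspace_localization.

(** * The weights of the theorem *)

Section integrals_of_weights.
Context {R : realType}.
Notation L := (lebesgueType R).

Let mpos : measurable (`]0, +oo[%classic : set L).
Proof. exact: measurable_lebesgue_itv. Qed.
Let mtail : measurable (`[1, +oo[%classic : set L).
Proof. exact: measurable_lebesgue_itv. Qed.

Lemma tail_pos : `[1, +oo[%classic `<=` (`]0, +oo[%classic : set R).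
Proof. by move=> t /=; rewrite !in_itv /= !andbT; exact: lt_le_trans. Qed.

Lemma powRVN (x r : R) : 0 < x -> (x^-1) `^ r = x `^ (- r).
Proof. by move=> x0; rewrite -powR_inv1 ?ltW // -powRrM mulN1r. Qed.

Definition density (b : R -> R) (r : R) (t : R) : R := t^-1 * b t `^ (- r).

Lemma density_gt0 b r t : slowly_varying b -> 0 < t -> 0 < density b r t.
Proof.
by move=> [_ b0 _] t0; rewrite mulr_gt0 ?invr_gt0 // powR_gt0 // b0.
Qed.

Lemma measurable_density b r (D : set L) : slowly_varying b -> measurable D ->
  D `<=` `]0, +oo[%classic -> measurable_fun D (density b r).
Proof.
move=> [mb _ _] mD D0.
have mi := measurable_lebesgue_inv mD D0.
have mbD := measurable_funS mpos D0 mb.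
exact: (measurable_funM mi (measurableT_comp (measurable_powR (- r)) mbD)).
Qed.

(** As [(b t)^-1] grows at most like [t `^ 2^-1], the integrand is at most a
    multiple of [t `^ (- (1 + r / 2))]. *)
Lemma slowly_varying_tail_lty (b : R -> R) (r : R) : slowly_varying b -> 1 <= r ->
  (\int[leb]_(t in (`[1%R, +oo[%classic : set L))
     (t^-1 * (t^-1 / b t) `^ r)%:E < +oo)%E.
Proof.
move=> sb r1; have [mb b0 _] := sb; have [C C0 bC] := slowly_varying_inv_le sb.
have r0 : 0 < r := lt_le_trans ltr01 r1.
pose p := 1 + r / 2.
have p1 : 1 < p by rewrite ltrDl divr_gt0.
have mp (s : R) := measurable_lebesgue_powR s mtail.
have mt := mp (- p).
have mb' : measurable_fun (`[1, +oo[%classic : set L) (fun t : L => t^-1 * (t^-1 / b t) `^ r).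
  have mi := measurable_lebesgue_inv mtail tail_pos.
  have mbi : measurable_fun (`[1, +oo[%classic : set L) (fun t : L => (b t)^-1).
    apply: (eq_measurable_fun (fun t : L => b t `^ (-1))).
      move=> t /set_mem /tail_pos /=; rewrite in_itv /= andbT => t0.
      by rewrite powR_inv1 // ltW // b0.
    exact: (measurableT_comp (measurable_powR (-1)) (measurable_funS mpos tail_pos mb)).
  exact: (measurable_funM mi
    (measurableT_comp (measurable_powR r) (measurable_funM mi mbi))).
apply: (@le_lt_trans _ _ (\int[leb]_(t in (`[1%R, +oo[%classic : set L))
    ((C `^ r)%:E * (t `^ (- p))%:E))%E).
  apply: (ge0_le_integral leb mtail).
  - move=> t /tail_pos /=; rewrite in_itv /= andbT => t0.
    by rewrite lee_fin mulr_ge0 ?powR_ge0 // invr_ge0 ltW.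
  - exact/measurable_EFinP.
  - by apply: measurable_funeM; exact/measurable_EFinP.
  move=> t /=; rewrite in_itv /= andbT => t1.
  have t0 : 0 < t := lt_le_trans ltr01 t1.
  have le1 : t^-1 / b t <= C * t `^ (- 2^-1).
    have -> : t `^ (- 2^-1) = t^-1 * t `^ 2^-1.
      rewrite -[t^-1]powR_inv1 ?(ltW t0) // -powRD; last by rewrite (gt_eqF t0) implybT.
      by congr (_ `^ _); field.
    by rewrite mulrCA ler_pM2l ?invr_gt0 // bC.
  rewrite -EFinM lee_fin.
  have -> : t `^ (- p) = t^-1 * (t `^ (- 2^-1)) `^ r.
    rewrite -powRrM -[t^-1]powR_inv1 ?(ltW t0) // -powRD; last by rewrite (gt_eqF t0) implybT.
    by congr (_ `^ _); rewrite /p; field.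
  rewrite mulrCA ler_pM2l ?invr_gt0 // -powRM ?powR_ge0 ?(ltW C0) //.
  apply: ge0_ler_powR => //; rewrite ?nnegrE ?(ltW r0) //.
    by rewrite divr_ge0 ?invr_ge0 ?ltW // b0.
  by rewrite mulr_ge0 ?powR_ge0 // ltW.
rewrite (ge0_integralZl leb mtail).
- apply: lte_mul_pinfty => //; first by rewrite lee_fin powR_ge0.
  exact: integral_tail_powR_lty.
- exact/measurable_EFinP.
- by move=> t _; rewrite lee_fin powR_ge0.
- by rewrite lee_fin powR_ge0.
Qed.

Section primitive_weight.
Variables (A : R -> R) (q : \bar R) (q' : R).
Hypotheses (hA : slowly_varying A) (hq : (1 < q)%E)
  (Afin : forall x, 0 < x ->
    (\int[leb]_(t in (`]0%R, x[%classic : set L)) (density A q' t)%:E < +oo)%E).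

Let w := density A q'.
Let W (x : R) : R := fine (\int[leb]_(t in (`]0%R, x[%classic : set L)) (w t)%:E)%E.

Let w_ge0 t : 0 < t -> 0 <= w t.
Proof. by move=> t0; exact/ltW/density_gt0. Qed.

Let mw : measurable_fun (`]0, +oo[%classic : set L) w.
Proof. exact: measurable_density. Qed.

Let WE x : 0 < x ->
  (\int[leb]_(t in (`]0%R, x[%classic : set L)) (w t)%:E = (W x)%:E)%E.
Proof.
move=> x0; rewrite /W fineK // ge0_fin_numE ?Afin //.
by apply: integral_ge0 => t /=; rewrite in_itv /= lee_fin => /andP[/w_ge0].
Qed.

Let W_gt0 x : 0 < x -> 0 < W x.
Proof.
move=> x0; rewrite -lte_fin -WE //.
set D : set L := `]0, x[%classic.
have mD : measurable D by exact: measurable_lebesgue_itv.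
have Dpos : D `<=` `]0, +oo[%classic.
  by move=> t; rewrite /D /= !in_itv /= => /andP[->].
have D0 : (0 < leb D)%E.
  by rewrite [X in (_ < X)%E](lebesgue_itv_oo (ltW x0)) subr0 lte_fin.
have mwD : measurable_fun setT (w \_ D : L -> R).
  apply/(measurable_restrictT (w : L -> R) mD); exact: measurable_density.
have := Lnorm_gt0 mD D0 mwD (lte01 : (0 < 1)%E).
rewrite Lnorm1 => h.
rewrite integral_mkcond (eq_integral (fun t => `|(EFin \o (w \_ D : L -> R)) t|%E)).
  apply: h => t Dt; rewrite patchE mem_set // gt_eqF // density_gt0 //.
  by move: (Dpos t Dt); rewrite /= in_itv /= andbT.
move=> t _; rewrite /= !patchE; case: ifPn => [/set_mem|_]; last by rewrite normr0.
by move=> /Dpos /=; rewrite in_itv /= andbT => t0; rewrite ger0_norm // w_ge0.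
Qed.

(** The weight [B] of the theorem. *)
Definition primitive_weight (x : R) : R :=
  A x `^ (- (q' * fine (q^-1)%E)) * (W x)^-1.

Lemma primitive_weight_gt0 t : 0 < t -> 0 < primitive_weight t.
Proof.
by move=> t0; case: hA => _ A0 _; rewrite mulr_gt0 ?powR_gt0 ?A0 // invr_gt0 W_gt0.
Qed.

Let mWp (D : set L) (r : R) : measurable D -> D `<=` `]0, +oo[%classic ->
  measurable_fun D (fun t : L => W t `^ r).
Proof.
move=> mD D0; apply: (measurableT_comp (measurable_powR r)).
exact: (measurable_primitive mw w_ge0 WE).
Qed.

Lemma measurable_primitive_weight :
  measurable_fun (`]0, +oo[%classic : set L) primitive_weight.
Proof.
have [mA A0 _] := hA.
apply: measurable_funM; first exact: (measurableT_comp (measurable_powR _) mA).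
apply: (eq_measurable_fun (fun t : L => W t `^ (-1))).
  move=> t /set_mem /=; rewrite in_itv /= andbT => t0.
  by rewrite powR_inv1 // ltW // W_gt0.
exact: mWp.
Qed.

(** For finite [q] the [q]-th power of the weight is [w * W `^ (- q)]; for
    [q = +oo] the weight is [W^-1], which is nonincreasing. *)
Lemma Lnorm_primitive_weight_lty :
  ('N[leb]_q[EFin \o (weight q primitive_weight \_ (`[1%R, +oo[%classic : set L))] < +oo)%E.
Proof.
have [_ A0 _] := hA.
rewrite /weight /primitive_weight.
case: q hq => [r|_|//]; last first.
  rewrite unlock /Lnorm; case: ifP => // _.
  apply: (@le_lt_trans _ _ (W 1)^-1%:E); last exact: ltry.
  apply/ess_supP/aeW => t /=; rewrite lee_fin patchE.
  case: ifPn => [/set_mem /=|_]; last by rewrite normr0 invr_ge0 ltW // W_gt0.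
  rewrite in_itv /= andbT => t1; have t0 : 0 < t := lt_le_trans ltr01 t1.
  rewrite /= mulr0 oppr0 !powRr0 !mul1r.
  have Wt := W_gt0 t0; have W1 := W_gt0 (@ltr01 R).
  rewrite ger0_norm ?invr_ge0 ?(ltW Wt) // lef_pV2 ?posrE //.
  exact: (primitive_homo mw w_ge0 WE).
rewrite lte_fin => r1; have r0 : 0 < r := lt_trans ltr01 r1.
rewrite LnormEr poweR_lty //.
have := integral_primitive_powR_lty mw w_ge0 WE (W_gt0 ltr01) r1.
rewrite [X in (X < _)%E -> _]integral_mkcond.
congr (_ < _)%E; apply: eq_integral => t _; rewrite !patchE.
case: ifPn => [/set_mem /=|_]; last by rewrite normr0 powR0 // gt_eqF.
rewrite in_itv /= andbT => t1; have t0 : 0 < t := lt_le_trans ltr01 t1.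
have Wt := W_gt0 t0.
rewrite ger0_norm; last by rewrite !mulr_ge0 ?powR_ge0 // invr_ge0 ltW.
rewrite inver gt_eqF //=.
rewrite !powRM ?powR_ge0 ?mulr_ge0 ?powR_ge0 ?invr_ge0 ?(ltW Wt) //.
have e1 : - r^-1 * r = -1 by rewrite mulNr mulVf ?gt_eqF.
have e2 : - (q' / r) * r = - q' by rewrite mulNr -mulrA mulVf ?gt_eqF // mulr1.
rewrite -!powRrM powRVN // e1 e2 powR_inv1 ?(ltW t0) //.
by rewrite /w /density mulrA.
Qed.

End primitive_weight.
End integrals_of_weights.

(** The density of [A] is that of [a] up to [1], and beyond it is at most a
    multiple of that of [alpha]; it is therefore at most the sum of the two. *)
Lemma integral_density_lty (R : realType) (a alpha A : R -> R) (q' : R) :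
  0 <= q' -> slowly_varying a -> slowly_varying alpha -> slowly_varying A ->
  (forall x, 0 < x <= 1 -> A x = a x) ->
  equivalent_on `]1, +oo[ A alpha ->
  (\int[leb]_(t in (`]0%R, +oo[%classic : set (lebesgueType R)))
     (density a q' t)%:E < +oo)%E ->
  (forall x, 0 < x -> (\int[leb]_(t in (`]0%R, x[%classic : set (lebesgueType R)))
     (density alpha q' t)%:E < +oo)%E) ->
  forall x, 0 < x -> (\int[leb]_(t in (`]0%R, x[%classic : set (lebesgueType R)))
     (density A q' t)%:E < +oo)%E.
Proof.
move=> q'0 sa sal sA Aa [c1 [c2 [c10 c20 Aal]]] fa fal x x0.
set D : set (lebesgueType R) := `]0, x[%classic.
have mD : measurable D by exact: measurable_lebesgue_itv.
have mpos : measurable (`]0, +oo[%classic : set (lebesgueType R)).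
  exact: measurable_lebesgue_itv.
have Dpos : D `<=` `]0, +oo[%classic.
  by move=> t; rewrite /D /= !in_itv /= => /andP[->].
have pos t : D t -> 0 < t by move/Dpos; rewrite /= in_itv /= andbT.
have dens0 b t : slowly_varying b -> D t -> (0 <= (density b q' t)%:E)%E.
  by move=> sb /pos t0; rewrite lee_fin ltW // density_gt0.
have mdens b : slowly_varying b -> measurable_fun D (EFin \o density b q').
  by move=> sb; apply/measurable_EFinP; exact: measurable_density.
have c0 : (0 <= (c2 `^ q')%:E)%E by rewrite lee_fin powR_ge0.
have mc := measurable_funeM (c2 `^ q')%:E (mdens _ sal).
apply: (@le_lt_trans _ _ (\int[leb]_(t in D)
    ((density a q' t)%:E + (c2 `^ q')%:E * (density alpha q' t)%:E))%E).
  apply: (ge0_le_integral leb mD).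
  - by move=> t; exact: dens0.
  - exact: mdens.
  - exact: (emeasurable_funD (mdens _ sa) mc).
  move=> t Dt; have t0 := pos t Dt.
  have [t1|t1] := leP t 1.
    rewrite {1}/density Aa ?t0 // leeDl // mule_ge0 //; exact: dens0.
  rewrite -[leLHS]add0e; apply: leeD; first exact: dens0.
  rewrite -EFinM lee_fin /density mulrCA ler_pM2l ?invr_gt0 //.
  have [_ le2] : A t <= c1 * alpha t /\ alpha t <= c2 * A t.
    by apply: Aal; rewrite /= in_itv /= t1.
  have [At alt] : 0 < A t /\ 0 < alpha t.
    by case: sA sal => _ A0 _ [_ al0 _]; rewrite A0 // al0.
  have [AV alV] : 0 <= (A t)^-1 /\ 0 <= (alpha t)^-1 by rewrite !invr_ge0 !ltW.
  rewrite -!powRVN // -powRM // ?(ltW c20) //.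
  apply: ge0_ler_powR => //; first by rewrite nnegrE mulr_ge0 // ltW.
  by rewrite ler_pdivlMr // ler_pdivrMl // mulrC.
rewrite (ge0_integralD leb mD).
- apply: lte_add_pinfty.
    apply: le_lt_trans fa; apply: (ge0_subset_integral leb mD mpos _ _ Dpos).
    + by apply/measurable_EFinP; exact: measurable_density.
    + move=> t /=; rewrite in_itv /= andbT => t0.
      by rewrite lee_fin ltW // density_gt0.
  rewrite (ge0_integralZl leb mD (mdens _ sal) (fun t Dt => dens0 _ t sal Dt) c0).
  exact: (lte_mul_pinfty c0 _ (fal _ x0)).
- by move=> t; exact: dens0.
- exact: mdens.
- by move=> t Dt; rewrite mule_ge0 // dens0.
- exact: mc.
Qed.

Theorem mainTheorem7 (R : realType) (Z : topologicalLmodType R)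
    (X0 X1 : completeNormedModType R)
    (i0 : {linear X0 -> Z}) (i1 : {linear X1 -> Z})
    (hX : compatible_couple i0 i1)
    (q : \bar R) (hq : (1 < q)%E)
    (q' : R) (hq' : q' = fine (hoelder_conjugate q))
    (a : R -> R) (ha : slowly_varying a)
    (ha_int : (\int[leb]_(t in `]0%R, +oo[) (t^-1 * a t `^ (- q'))%:E < +oo)%E)
    (alpha : R -> R) (halpha : slowly_varying alpha)
    (halpha_fin : forall x : R, 0 < x ->
      (\int[leb]_(t in `]0%R, x[) (t^-1 * alpha t `^ (- q'))%:E < +oo)%E)
    (halpha_inf :
      (\int[leb]_(t in `]0%R, +oo[) (t^-1 * alpha t `^ (- q'))%:E = +oo)%E)
    (A : R -> R) (hA : slowly_varying A)
    (hAa : forall x : R, 0 < x <= 1 -> A x = a x)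
    (hAalpha : equivalent_on `]1, +oo[ A alpha)
    (B : R -> R)
    (hB : forall x : R, 0 < x ->
      B x = A x `^ (- (q' * fine (q^-1)%E)) *
            (\int[leb]_(t in `]0, x[) (t^-1 * A t `^ (- q')))^-1) :
  let Y0 := embedded i0 in
  let Y1 := embedded i1 in
  [/\ same_space (Jspace Y0 Y1 q a `]0, +oo[) (Jspace Y0 Y1 q a `]0, 1[),
      same_space (Jspace Y0 (capS Y0 Y1) q A `]0, +oo[)
                 (Jspace Y0 (capS Y0 Y1) q A `]0, 1[) &
      same_space (Kspace Y0 (capS Y0 Y1) q B `]0, +oo[)
                 (Kspace Y0 (capS Y0 Y1) q B `]0, 1[)].
Proof.
move=> Y0 Y1; have [_ inj0 _ inj1 _] := hX.
have s0 : seminormed Y0 by exact: embedded_seminormed.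
have s1 : seminormed Y1 by exact: embedded_seminormed.
have sC : seminormed (capS Y0 Y1) by exact: capS_seminormed.
have cC : complete_in (capS Y0 Y1) by exact: capS_complete.
have cC' : complete_in (capS Y0 (capS Y0 Y1)) by rewrite capS_capS.
have [q'1 _ _] := hoelder_conjugate_real hq hq'.
have le_cap x : nrm Y0 x <= nrm (capS Y0 Y1) x by rewrite /= le_max lexx.
have [_ a0 _] := ha.
have Afin := integral_density_lty (le_trans ler01 q'1) ha halpha hA hAa hAalpha
  ha_int halpha_fin.
have BE t : 0 < t -> primitive_weight A q q' t = B t by move=> t0; rewrite hB.
split.
- apply: (same_Jspace s0 s1 cC (psi := fun=> 1) hq hq' ha).
  + exact: measurable_cst.
  + move=> t x t1 _; rewrite mul1r ge_max !le_max lexx /=.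
    by rewrite ler_peMl ?orbT // (nrm_ge0 s1).
  + by [].
  + rewrite (eq_integral (fun t : lebesgueType R => (density a q' t)%:E)); last first.
      move=> t /set_mem /tail_pos /=; rewrite in_itv /= andbT => t0.
      by rewrite div1r powRVN // a0.
    have mpos : measurable (`]0, +oo[%classic : set (lebesgueType R)).
      exact: measurable_lebesgue_itv.
    apply: le_lt_trans ha_int.
    apply: (ge0_subset_integral leb (measurable_lebesgue_itv _) mpos).
    * by apply/measurable_EFinP; exact: (measurable_density _ ha mpos).
    * move=> t /=; rewrite in_itv /= andbT => t0.
      by rewrite lee_fin; exact/ltW/(density_gt0 _ ha).
    * exact: tail_pos.
- apply: (same_Jspace s0 sC cC' (psi := fun t => t^-1) hq hq' hA).
  + exact: (measurable_lebesgue_inv (measurable_lebesgue_itv _) (@tail_pos R)).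
  + move=> t x t1 _; have t0 : 0 < t := lt_le_trans ltr01 t1.
    rewrite capS_capS -[leLHS](mulKf (lt0r_neq0 t0)) ler_pM2l ?invr_gt0 //.
    by rewrite le_max lexx orbT.
  + by move=> t t1; rewrite invr_ge0 (le_trans _ t1).
  + exact: slowly_varying_tail_lty.
- apply: (same_Kspace s0 sC _ _ hq).
  + by move=> x [].
  + by move=> x _; exact: le_cap.
  + apply: (eq_measurable_fun (primitive_weight A q q' : lebesgueType R -> R)).
      by move=> t /set_mem /=; rewrite in_itv /= andbT; exact: BE.
    exact: measurable_primitive_weight.
  + by move=> t t0; rewrite -BE //; exact: primitive_weight_gt0.
  + have := Lnorm_primitive_weight_lty hA hq Afin.
    congr ('N[leb]_q[EFin \o _] < +oo)%E; apply/funext => t; rewrite !patchE.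
    case: ifPn => // /set_mem /tail_pos /=; rewrite in_itv /= andbT => t0.
    by rewrite /weight BE.
Qed.
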